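(* Let $z\in\mathbb C^n\setminus\Delta$. The operators $K_j(z)^*:V^*\to V^*$, $j\in J$, preserve the subspaces $\operatorname{Sing}W\subset W\subset V^*$. The operators $K_j(z)^*|_W:W\to W$ are symmetric with respect to the contravariant form. The operators $K_j(z)^*|_{\operatorname{Sing}W}:\operatorname{Sing}W\to\operatorname{Sing}W$, $j\in J$, commute.
   Context: Let $0<k<n$ be integers and $J=\{1,\dots,n\}$. Fix nonzero linear functions $g_j=b_j^1t_1+\dots+b_j^kt_k$, $j\in J$, on $\mathbb C^k$ ($b_j^i\in\mathbb C$) spanning the dual space of $\mathbb C^k$, and nonzero complex weights $a=(a_j)_{j\in J}$. For $z\in\mathbb C^n$ put $f_j(z,t)=z_j+g_j(t)$, $H_j(z)=\{t\in\mathbb C^k: f_j(z,t)=0\}$; $\mathcal A(z)=(H_j(z))_{j\in J}$ is an arrangement in $\mathbb C^k$ with complement $U(\mathcal A(z))=\mathbb C^k\setminus\bigcup_jH_j(z)$. A circuit is a subset $C\subset J$ such that $(g_i)_{i\in C}$ is linearly dependent while every proper subset is linearly independent; $\mathfrak C$ is the set of circuits. For $C\in\mathfrak C$ fix numbers $(\lambda^C_i)_{i\in C}$, not all zero, with $\sum_{i\in C}\lambda_i^Cg_i=0$; put $\lambda_i^C=0$ for $i\notin C$, $f_C(z)=\sum_{i\in J}\lambda_i^Cz_i$ and $\Delta=\bigcup_{C\in\mathfrak C}\{f_C=0\}\subset\mathbb C^n$. Spaces. For $z\in\mathbb C^n$ let $\omega_j(z)=dg_j/f_j(z,\cdot)$,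 a form on $U(\mathcal A(z))$; $\mathrm{OS}^p(z)$ is the complex span of all $\omega_{j_1}(z)\wedge\dots\wedge\omega_{j_p}(z)$ ($\mathrm{OS}^0=\mathbb C$), $\mathcal F^k(z)=\mathrm{OS}^k(z)^*$, and $\operatorname{Sing}\mathcal F^k(z)$ is the annihilator of $\nu\wedge\mathrm{OS}^{k-1}(z)$, where $\nu=\sum_ja_j\omega_j(z)$. Call $\{j_1,\dots,j_k\}\subset J$ independent if $g_{j_1},\dots,g_{j_k}$ are linearly independent. For $z\in\mathbb C^n\setminus\Delta$ the forms $\omega_{j_1}(z)\wedge\dots\wedge\omega_{j_k}(z)$ over independent $\{j_1<\dots<j_k\}$ form a basis of $\mathrm{OS}^k(z)$; this identifies all $\mathrm{OS}^k(z)$, $z\notin\Delta$, with one space $V^*$ with basis $(H_{j_1},\dots,H_{j_k})$. Its dual $V=\mathcal F^k(z)$ has the dual basis $F(H_{j_1},\dots,H_{j_k})$ (extended to all orderings by skew-symmetry), and $\operatorname{Sing}V=\operatorname{Sing}\mathcal F^k(z)\subset V$ does not depend on $z\notin\Delta$. The contravariant form $S^{(a)}$ on $V$ is the symmetric bilinear form for which this basis is orthogonal and $S^{(a)}(F(H_{j_1},\dots,H_{j_k}),F(H_{j_1},\dots,H_{j_k}))=a_{j_1}\cdots a_{j_k}$. $W\subset V^*$ and $\operatorname{Sing}W\subset W$ are the images of $V$ and $\operatorname{Sing}V$ under the map $V\to V^*$, $x\mapsto S^{(a)}(x,\cdot)$; the induced nondegenerate form on $W$ is also denoted $S^{(a)}$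 and called contravariant. For $M:V\to V$, $M^*:V^*\to V^*$ is the dual operator. Operators. For a circuit $C=\{i_1,\dots,i_r\}$ define $L_C:V\to V$ on basis vectors by $L_CF(H_{j_1},\dots,H_{j_k})=0$ if $|\{j_1,\dots,j_k\}\cap C|<r-1$, and, for independent sets containing all elements of $C$ but $i_m$, $$L_CF(H_{i_1},\dots,\widehat{H_{i_m}},\dots,H_{i_r},H_{s_1},\dots,H_{s_{k-r+1}})=(-1)^m\sum_{l=1}^r(-1)^la_{i_l}F(H_{i_1},\dots,\widehat{H_{i_l}},\dots,H_{i_r},H_{s_1},\dots,H_{s_{k-r+1}}).$$ Put $K_j(z)=\sum_{C\in\mathfrak C}\frac{\lambda_j^C}{f_C(z)}L_C$ for $z\in\mathbb C^n\setminus\Delta$, $j\in J$. *)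

(* Defs.v *)
From HB Require Import structures.
From mathcomp Require Import all_boot all_order all_fingroup all_algebra.

Set Implicit Arguments.
Unset Strict Implicit.
Unset Printing Implicit Defensive.

Import GRing.Theory.

Local Open Scope ring_scope.

Section Arrangement.
Context (F : fieldType) (n k : nat).
Implicit Types (b : 'M[F]_(n, k)) (a : 'I_n -> F) (z : 'I_n -> F).
Implicit Types (C : {set 'I_n}) (lam : {set 'I_n} -> 'I_n -> F).

(* Row j of b is the coefficient vector (b_j^1, ..., b_j^k) of g_j. *)
Definition glin b (j : 'I_n) (t : 'cV[F]_k) : F := \sum_(i < k) b j i * t i 0.

(* The families (g_j)_{j in A} are represented by their coefficient vectors. *)
Definition indep b (A : {set 'I_n}) : bool :=
  free [seq row j b | j <- enum A].

Definition circuit b C : bool :=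
  ~~ indep b C && [forall D : {set 'I_n}, (D \proper C) ==> indep b D].

Definition circuit_coeffs b lam : Prop :=
  forall C, circuit b C ->
    [/\ exists2 i, i \in C & lam C i != 0,
        \sum_(i in C) lam C i *: row i b = 0
      & forall i, i \notin C -> lam C i = 0].

Definition fcirc lam C z : F := \sum_(i < n) lam C i * z i.

Definition Delta b lam z : Prop :=
  exists2 C, circuit b C & fcirc lam C z = 0.

Definition faff b z (j : 'I_n) (t : 'cV[F]_k) : F := z j + glin b j t.

Definition in_compl b z (t : 'cV[F]_k) : Prop := forall j, faff b z j t != 0.

(* A p-form: its value at a point t on p tangent vectors.  Only its values at
   the points of the complement U(A(z)) are relevant. *)
Definition dform (p : nat) := 'cV[F]_k -> ('I_p -> 'cV[F]_k) -> F.
Definition form1 := 'cV[F]_k -> 'cV[F]_k -> F.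

Definition eq_form b z p (eta theta : dform p) : Prop :=
  forall t, in_compl b z t -> forall v, eta t v = theta t v.

Definition wedges p (alpha : 'I_p -> form1) : dform p :=
  fun t v => \det (\matrix_(i < p, j < p) alpha i t (v j)).

(* For p > 0, alpha /\ eta with eta of degree p - 1; the convention is
   that of [wedges], see [wedge_wedges]. *)
Definition wedge p (alpha : form1) (eta : dform p.-1) : dform p :=
  fun t v => \sum_(i < p)
    (-1) ^+ i * alpha t (v i) * eta t (fun j : 'I_p.-1 => v (lift i j)).

Definition omega b z (j : 'I_n) : form1 := fun t v => glin b j v / faff b z j t.

Definition omegas b z p (s : p.-tuple 'I_n) : dform p :=
  wedges (fun i => omega b z (tnth s i)).

Definition OS b z p (eta : dform p) : Prop :=
  exists c : p.-tuple 'I_n -> F,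
    eq_form b z eta (fun t v => \sum_s c s * omegas b z s t v).

Definition nu b a z : form1 := fun t v => \sum_(j < n) a j * omega b z j t v.

Definition kindep b : Type := {I : {set 'I_n} | (#|I| == k) && indep b I}.

(* V in coordinates with respect to the basis F(H_{j_1}, ..., H_{j_k}),
   {j_1 < ... < j_k} independent. *)
Definition V b : Type := {ffun kindep b -> F^o}.

Definition Vdual b : Type := 'Hom(V b, F^o).

Definition Fbasis b (I : kindep b) : V b := [ffun I' => (I == I')%:R].

(* F(H_{j_1}, ..., H_{j_k}) for a sequence s = (j_1, ..., j_k) in any order:
   the determinant is the sign of the permutation sorting s when s enumerates
   I (as enum (val I) is increasing), and 0 otherwise. *)
Definition Fflag b (s : seq 'I_n) : V b :=
  [ffun I : kindep b => \det (\matrix_(i < k, j < k)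
                    (onth s i == onth (enum (val I)) j)%:R)].

(* The identification of V^* with OS^k(z): the basis vector (H_{j_1}, ...,
   H_{j_k}) of V^*, dual to F(H_{j_1}, ..., H_{j_k}), corresponds to
   omega_{j_1}(z) /\ ... /\ omega_{j_k}(z). *)
Definition kindep_tuple b (I : kindep b) : k.-tuple 'I_n :=
  tcast (eqP (proj1 (andP (valP I)))) (enum_tuple (val I)).

Definition to_OS b z (phi : Vdual b) : dform k :=
  fun t v => \sum_(I : kindep b) phi (Fbasis I) * omegas b z (kindep_tuple I) t v.

(* The annihilator of nu /\ OS^{k-1}(z) in V = OS^k(z)^*. *)
Definition SingV b a z (x : V b) : Prop :=
  forall eta : dform k.-1, OS b z eta ->
  forall phi : Vdual b, eq_form b z (to_OS z phi) (wedge (nu b a z) eta) ->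
  phi x = 0.

Definition Sform b a (x y : V b) : F :=
  \sum_(I : kindep b) (\prod_(j in val I) a j) * x I * y I.

Definition Smap b a : 'Hom(V b, Vdual b) :=
  linfun (fun x : V b => linfun (Sform a x : V b -> F^o) : Vdual b).

Definition W b a : {vspace Vdual b} := limg (Smap b a).

Definition SingW b a z (phi : Vdual b) : Prop :=
  exists2 x : V b, SingV a z x & phi = Smap b a x.

(* (Smap b a)^-1 picks preimages under Smap; on W the result does not depend
   on this choice, see [SformW_Smap]. *)
Definition SformW b a (phi psi : Vdual b) : F :=
  Sform a ((Smap b a)^-1%VF phi) ((Smap b a)^-1%VF psi).

(* L_C on the basis vector F(H_{j_1}, ..., H_{j_k}), {j_1, ..., j_k} = I.
   There is at most one m in C with C \ m included in I (I is independent), and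
   there is one iff #|I :&: C| = #|C| - 1.  For it, the coefficient
   Fflag (...) I is the sign c such that
   F(H_I) = c F(H_{i_1}, .., ^H_{i_m}, .., H_{i_r}, H_{s_1}, .., H_{s_{k-r+1}}).
   Positions in enum C are counted from 0, which leaves (-1)^m (-1)^l
   unchanged.  [LC_far] and [LC_Fflag] below give the usual characterization. *)
Definition LC_basis b a C (I : kindep b) : V b :=
  \sum_(m in C | C :\ m \subset val I)
    Fflag b (enum (C :\ m) ++ enum (val I :\: C)) I *:
    ((-1) ^+ index m (enum C) *:
     \sum_(l in C) ((-1) ^+ index l (enum C) * a l) *:
        Fflag b (enum (C :\ l) ++ enum (val I :\: C))).

Definition LC b a C : 'End(V b) :=
  linfun (fun x : V b => \sum_(I : kindep b) x I *: LC_basis a C I : V b).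

Definition Kop b a lam z (j : 'I_n) : 'End(V b) :=
  \sum_(C | circuit b C) (lam C j / fcirc lam C z) *: LC b a C.

Definition dualop b (M : 'End(V b)) (phi : Vdual b) : Vdual b := (phi \o M)%VF.

Lemma wedge_wedges p (alpha : 'I_p.+1 -> form1) t v :
  wedge (alpha ord0) (wedges (fun i => alpha (lift ord0 i))) t v =
  wedges alpha t v.
Proof.
rewrite /wedges (expand_det_row _ ord0); apply: eq_bigr => i _.
rewrite mxE -mulrA mulrCA /cofactor add0n; congr (_ * (_ * \det _)).
by apply/matrixP => r s; rewrite !mxE.
Qed.

Lemma size_kindep b (I : kindep b) : size (enum (val I)) = k.
Proof. by rewrite -cardE; case/andP: (valP I) => /eqP. Qed.

Lemma Fflag_enum b (I : kindep b) : Fflag b (enum (val I)) = Fbasis I.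
Proof.
apply/ffunP => I'; rewrite !ffunE.
have [<-|neqI] := eqVneq I I'.
  transitivity (\det (1%:M : 'M[F]_k)); last by rewrite det1.
  congr (\det _); apply/matrixP => i j; rewrite !mxE.
  congr (_ *+ nat_of_bool _).
  apply/idP/idP => [/eqP|/eqP-> //].
  move=> eqij; apply/eqP/val_inj; apply: onth_inj eqij; first exact: enum_uniq.
  by rewrite size_kindep gtn_min ltn_ord.
have /subsetPn[x xI xI'] : ~~ (val I \subset val I').
  apply: contraNN neqI => sII'; apply/eqP/val_inj/eqP.
  by rewrite eqEcard sII' !cardE !size_kindep /=.
have /onthP[i xi] : x \in enum (val I) by rewrite mem_enum.
have ltik : (i < k)%N by rewrite -(size_kindep I) -onthTE xi.
rewrite (expand_det_row _ (Ordinal ltik)) big1 // => j _; rewrite mxE /= xi.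
rewrite eq_sym (negPf (onthPn _ _)) ?mul0r //.
by rewrite mem_enum.
Qed.

Lemma Fflag_perm b s s' : size s' = k -> perm_eq s s' ->
  exists e : bool, forall f : 'I_n -> 'I_n,
    Fflag b (map f s) = (-1) ^+ e *: Fflag b (map f s').
Proof.
move=> sz; have sz2 : size s' == k by apply/eqP.
rewrite -[s']/(val (Tuple sz2)) => /tuple_permP[p ->]; exists (odd_perm p) => f.
apply/ffunP => I; rewrite !ffunE.
set A := (X in _ *: \det X); rewrite [RHS](_ : _ = (-1) ^+ p * \det A) //.
rewrite -det_perm -det_mulmx -row_permE.
congr (\det _); apply/matrixP => i j.
rewrite !mxE (onth_map _ _ f) (onth_map _ _ f).
congr (_ *+ nat_of_bool (omap f _ == _)).
rewrite (proj1 (tnth_onth (tnth (Tuple sz2) (p i)) (Tuple sz2) _) erefl).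
by apply/tnth_onth; rewrite tnth_mktuple.
Qed.

Lemma Fflag_swap b u x y v : size (u ++ x :: y :: v) = k ->
  Fflag b (u ++ x :: y :: v) = - Fflag b (u ++ y :: x :: v).
Proof.
move=> sz; apply/ffunP => I; rewrite !ffunE.
have lt1 : (size u < k)%N by rewrite -sz size_cat /= -addSnnS leq_addr.
have lt2 : ((size u).+1 < k)%N by rewrite -sz size_cat /= -!addSnnS leq_addr.
set i1 := Ordinal lt1; set i2 := Ordinal lt2.
have ne12 : i1 != i2 by rewrite -val_eqE /= neq_ltn ltnSn.
set A := (X in _ = - \det X).
have -> : - \det A = (-1) ^+ odd_perm (tperm i1 i2) * \det A.
  by rewrite odd_tperm ne12 mulN1r.
rewrite -det_perm -det_mulmx -row_permE.
congr (\det _); apply/matrixP => i j; rewrite !mxE.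
congr (_ *+ nat_of_bool (_ == _)); rewrite !onth_cat.
case: tpermP => [-> | -> | /eqP ne1 /eqP ne2] /=.
- by rewrite ltnn subnn ltnNge leqnSn /= subSnn.
- by rewrite ltnn subnn ltnNge leqnSn /= subSnn.
case: ltnP => // le_ui; move: ne1 ne2; rewrite -!val_eqE /= => ne1 ne2.
move: (subnKC le_ui); case: (i - size u)%N => [|[|d]] //= eq_i.
  by rewrite -eq_i addn0 eqxx in ne1.
by rewrite -eq_i addn1 eqxx in ne2.
Qed.

Lemma Fflag_rot b u p x v : size (u ++ x :: p ++ v) = k ->
  Fflag b (u ++ p ++ x :: v) = (-1) ^+ size p *: Fflag b (u ++ x :: p ++ v).
Proof.
elim: p u => [|y p IHp] u sz; first by rewrite scale1r.
have sz' : size (rcons u y ++ x :: p ++ v) = k.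
  by rewrite -sz !size_cat size_rcons /= addSnnS.
rewrite /= -cat_rcons IHp // cat_rcons Fflag_swap.
  by rewrite scalerN exprS mulN1r scaleNr.
by rewrite -sz' cat_rcons.
Qed.


Lemma LC_Fbasis b a C (I : kindep b) : LC b a C (Fbasis I) = LC_basis a C I.
Proof.
have lin : linear (fun x : V b => \sum_I x I *: LC_basis a C I : V b).
  move=> c x y; rewrite scaler_sumr -big_split; apply: eq_bigr => J _ /=.
  by rewrite !ffunE scalerDl scalerA.
pose h := GRing.isLinear.Build F (V b) (V b) _ _ lin.
pose f : {linear V b -> V b} :=
  HB.pack (fun x : V b => \sum_I x I *: LC_basis a C I : V b) h.
rewrite (lfunE f) /= (bigD1 I) //= ffunE eqxx scale1r big1 ?addr0 // => J neJ.
by rewrite ffunE eq_sym (negPf neJ) scale0r.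
Qed.

Lemma LC_far b a C (I : kindep b) : (#|val I :&: C| < #|C|.-1)%N ->
  LC b a C (Fbasis I) = 0.
Proof.
move=> ltIC; rewrite LC_Fbasis /LC_basis big1 // => m /andP[mC sCI].
suff : (#|C|.-1 <= #|val I :&: C|)%N by rewrite leqNgt ltIC.
by rewrite (cardsD1 m C) mC /= subset_leq_card // subsetI sCI subsetDl.
Qed.

Definition sub1 (l m x : 'I_n) := if x == l then m else x.

Lemma map_sub1_id l m s : l \notin s -> map (sub1 l m) s = s.
Proof.
move=> ls; apply: map_id_in => x xs; rewrite /sub1.
by case: eqP => // eq_xl; rewrite -eq_xl xs in ls.
Qed.

Lemma rem_pivot (x : 'I_n) p q : x \notin p -> rem x (p ++ x :: q) = p ++ q.
Proof.
move=> xp; rewrite remE take_pivot // index_pivot //.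
by rewrite drop_cat ltnNge leqnSn /= subSnn /= drop0.
Qed.

Lemma pivot2 (q1 q2 q3 : seq 'I_n) x y (c := q1 ++ x :: q2 ++ y :: q3) :
  uniq c ->
  [/\ x != y, [/\ x \notin q1, x \notin q2 & x \notin q3],
      index x c = size q1 /\ index y c = (size q1 + (size q2).+1)%N,
      rem x c = q1 ++ q2 ++ y :: q3 & rem y c = q1 ++ x :: q2 ++ q3] /\
  [/\ y \notin q1, y \notin q2 & y \notin q3].
Proof.
move=> uc.
have /= : uniq (x :: y :: q1 ++ q2 ++ q3).
  rewrite -(perm_uniq (s1 := c)) // /c -[x :: y :: _]/([:: x] ++ [:: y] ++ _).
  apply/seq.permP => p; rewrite !(count_cat, cat1s) /= count_cat /=.
  by rewrite addnCA (addnCA (count p q2)) (addnCA (count p q1)) !count_cat.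
rewrite !inE !mem_cat !negb_or => /and3P[/and4P[xy x1 x2 x3] /and3P[y1 y2 y3] _].
have cE : c = (q1 ++ x :: q2) ++ y :: q3 by rewrite -catA.
have y12 : y \notin q1 ++ x :: q2.
  by rewrite mem_cat inE !negb_or y1 eq_sym xy.
split=> //; split=> //; first split.
- exact: index_pivot.
- by rewrite cE index_pivot // size_cat.
- exact: rem_pivot.
- by rewrite cE rem_pivot // -catA.
Qed.

Lemma Fflag_sub b c l m s : uniq c -> l \in c -> m \in c -> l != m ->
    l \notin s -> size (rem m c ++ s) = k ->
  Fflag b (rem l c ++ s) =
  (- ((-1) ^+ index m c * (-1) ^+ index l c)) *:
    Fflag b (map (sub1 l m) (rem m c ++ s)).
Proof.
move=> uc lc mc nlm ls sz.
have sg u v : - ((-1) ^+ (u + v.+1) * (-1) ^+ u) = (-1) ^+ v :> F.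
  by rewrite exprD exprS mulN1r mulrN mulNr opprK mulrAC -expr2 sqrr_sign mul1r.
have [q1 [q2 [q3 [cE|cE]]]] : exists q1 q2 q3,
    c = q1 ++ l :: q2 ++ m :: q3 \/ c = q1 ++ m :: q2 ++ l :: q3.
  case: (path.splitPr lc) mc => p1 p2; rewrite mem_cat inE eq_sym (negPf nlm) /=.
  case/orP => /path.splitPr[r1 r2].
    by exists r1, r2, p2; right; rewrite -catA.
  by exists p1, r1, r2; left.
- have := @pivot2 q1 q2 q3 l m; rewrite /= -cE => /(_ uc).
  case=> -[_ [l1 l2 l3] [il im] rl rm] _.
  rewrite rl rm il im sg; rewrite rm in sz.
  rewrite !map_cat /= map_cat !map_sub1_id // /sub1 eqxx -!catA /= -!catA.
  rewrite Fflag_rot //.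
  by rewrite -sz -(cat1s m) -(cat1s l) !size_cat !addnA.
have := @pivot2 q1 q2 q3 m l; rewrite /= -cE => /(_ uc).
case=> -[_ _ [im il] rm rl] [l1 l2 l3].
rewrite rl rm il im mulrC sg; rewrite rm in sz.
rewrite !map_cat /= !map_sub1_id // /sub1 eqxx -!catA /= -!catA.
rewrite Fflag_rot ?scalerA -?expr2 ?sqrr_sign ?scale1r //.
by rewrite -sz -(cat1s m) -(cat1s l) !size_cat /= !addnA !addn1 !addSn.
Qed.

(* The value of L_C on F(s) for any ordering s of an independent set I with
   C \ I = {m}, without reference to an ordering of C. *)
Definition LCsub b a C m (s : seq 'I_n) : V b :=
  a m *: Fflag b s - \sum_(l in C :\ m) a l *: Fflag b (map (sub1 l m) s).

Lemma LCsubE b a C c m s : uniq c -> c =i C -> m \in c ->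
    {in s, forall x, x \notin C} -> size (rem m c ++ s) = k ->
  (-1) ^+ index m c *:
    (\sum_(l in C) ((-1) ^+ index l c * a l) *: Fflag b (rem l c ++ s)) =
  LCsub b a C m (rem m c ++ s).
Proof.
move=> uc cC mc sC sz; rewrite (bigD1 m) -?cC //= scalerDr scalerA mulrA -expr2.
rewrite sqrr_sign mul1r; congr (_ + _); rewrite scaler_sumr -sumrN.
apply: eq_big => [l|l /andP[lC nlm]]; first by rewrite !inE andbC.
have lc : l \in c by rewrite cC.
have ls : l \notin s by apply: contraL lC => /sC.
rewrite (Fflag_sub b uc lc mc nlm ls sz).
rewrite !scalerA -scaleNr; congr (_ *: _).
rewrite mulrN; congr (- _); rewrite mulrACA -expr2 sqrr_sign mul1r mulrAC.
by rewrite -expr2 sqrr_sign mul1r.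
Qed.

Lemma LCsub_perm b a C m s s' : size s' = k -> perm_eq s s' ->
  exists e : bool, Fflag b s = (-1) ^+ e *: Fflag b s' /\
    LCsub b a C m s = (-1) ^+ e *: LCsub b a C m s'.
Proof.
move=> sz /(Fflag_perm b sz)[e eP]; exists e.
have := eP id; rewrite !map_id => eP1; split=> //.
rewrite /LCsub eP1 scalerBr scalerA [a m * _]mulrC -scalerA; congr (_ - _).
rewrite scaler_sumr; apply: eq_bigr => l _.
by rewrite eP !scalerA mulrC.
Qed.

Lemma indepS b (A B : {set 'I_n}) : A \subset B -> indep b B -> indep b A.
Proof.
move=> sAB; rewrite /indep => freeB.
have : free [seq row j b | j <- enum A ++ enum (B :\: A)].
  rewrite (perm_free (Y := [seq row j b | j <- enum B])) //; apply: perm_map.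
  apply: uniq_perm; rewrite ?enum_uniq //.
    rewrite cat_uniq !enum_uniq andbT /=; apply/hasPn => x.
    by rewrite !mem_enum inE => /andP[].
  move=> x; rewrite mem_cat !mem_enum inE.
  by case: (boolP (x \in A)) => // /(subsetP sAB) ->.
by rewrite map_cat => /catl_free.
Qed.

(* The defining formula of L_C, for all orderings c = (i_1, ..., i_r) of C and
   s = (s_1, ..., s_{k-r+1}), with m = i_m. *)
Lemma LC_Fflag b a C c m s : circuit b C -> uniq c -> c =i C -> m \in c ->
    uniq (rem m c ++ s) -> size (rem m c ++ s) = k ->
    indep b [set x in rem m c ++ s] ->
  LC b a C (Fflag b (rem m c ++ s)) =
  (-1) ^+ index m c *:
    \sum_(l in C) ((-1) ^+ index l c * a l) *: Fflag b (rem l c ++ s).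
Proof.
move=> circC uc cC mc us sz indI.
set A := [set x in rem m c ++ s] in indI.
have nCA : ~~ (C \subset A).
  by apply/negP => sCA; case/andP: circC; rewrite (indepS sCA indI).
have CmA : C :\ m \subset A.
  apply/subsetP => x; rewrite !inE mem_cat -cC => /andP[nxm xc].
  by rewrite mem_rem_uniq // inE /= nxm xc.
have mA : m \notin A.
  apply: contra nCA => mA; apply/subsetP => x xC.
  by have [->//|nxm] := eqVneq x m; apply: (subsetP CmA); rewrite !inE nxm.
have kA : #|A| == k by rewrite /A cardsE (card_uniqP us) sz.
pose I : kindep b := Sub A (introT andP (conj kA indI)).
have sC x : x \in s -> x \notin C.
  move=> xs; have [eq_xm|nxm] := eqVneq x m.
    by rewrite inE mem_cat -eq_xm xs orbT in mA.
  move: us; rewrite cat_uniq => /and3P[_ /hasPn/(_ x xs) + _].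
  by rewrite mem_rem_uniq // inE /= nxm cC.
rewrite LCsubE //.
have pA : perm_eq (rem m c ++ s) (enum (val I)).
  by apply: uniq_perm; rewrite ?enum_uniq // => x; rewrite mem_enum inE.
have [e [-> ->]] := LCsub_perm b a C m (size_kindep I) pA.
rewrite Fflag_enum linearZ; congr (_ *: _); rewrite [LHS]LC_Fbasis.
rewrite /LC_basis.
rewrite (big_pred1 m) => [|x]; last first.
  rewrite /=; apply/andP/eqP => [[xC sxA]|->]; last by rewrite -cC.
  apply/eqP; apply: contraNT mA => nxm; apply: (subsetP sxA).
  by rewrite !inE -cC mc eq_sym nxm.
have rE l : l \in C -> enum (C :\ l) = rem l (enum C).
  move=> lC; rewrite rem_filter ?enum_uniq // /enum_mem -filter_predI.
  by apply: eq_filter => x; rewrite !inE.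
have mC : m \in C by rewrite -cC.
under [X in _ *: (_ *: X)]eq_bigr => l lC do rewrite rE //.
have pB : perm_eq (enum (C :\ m) ++ enum (val I :\: C)) (enum (val I)).
  apply: uniq_perm; rewrite ?enum_uniq //.
    rewrite cat_uniq !enum_uniq andbT; apply/hasPn => x.
    by rewrite !mem_enum !inE negb_and => /andP[-> _]; rewrite orbT.
  move=> x; rewrite mem_cat !mem_enum !in_setD in_set1.
  have [->|nxm] /= := eqVneq x m; first by rewrite mC (negPf mA).
  case: (boolP (x \in C)) => //= xC; apply/esym.
  by apply: (subsetP CmA); rewrite !inE nxm.
have [d [FE LE]] := LCsub_perm b a C m (size_kindep I) pB.
rewrite FE LCsubE ?enum_uniq ?mem_enum -?rE //; first last.
- by rewrite (perm_size pB) size_kindep.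
- by move=> x; rewrite mem_enum inE => /andP[].
- by move=> x; rewrite mem_enum.
rewrite LE Fflag_enum.
have -> : ((-1) ^+ d *: Fbasis I : V b) I = (-1) ^+ d.
  by rewrite !ffunE eqxx; exact: mulr1.
by rewrite scalerA -expr2 sqrr_sign scale1r.
Qed.

Lemma SmapE b a (x y : V b) : Smap b a x y = Sform a x y.
Proof.
have lin2 u : linear (Sform a u : V b -> F^o).
  move=> c v w; rewrite /Sform scaler_sumr -big_split; apply: eq_bigr => I _.
  by rewrite !ffunE mulrDr /GRing.scale /= mulrCA.
pose f2 u : {linear V b -> F^o} :=
  HB.pack (Sform a u : V b -> F^o)
    (GRing.isLinear.Build F (V b) F^o _ _ (lin2 u)).
have lin1 : linear (fun u : V b => linfun (Sform a u : V b -> F^o) : Vdual b).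
  move=> c v w; apply/lfunP => u; rewrite add_lfunE scale_lfunE.
  rewrite (lfunE (f2 _)) (lfunE (f2 v)) (lfunE (f2 w)) /= /Sform scaler_sumr.
  rewrite -big_split; apply: eq_bigr => I _.
  by rewrite !ffunE mulrDr mulrDl /GRing.scale /= mulrCA !mulrA.
pose f1 : {linear V b -> Vdual b} :=
  HB.pack (fun u : V b => linfun (Sform a u : V b -> F^o) : Vdual b)
    (GRing.isLinear.Build F (V b) (Vdual b) _ _ lin1).
by rewrite (lfunE f1) /= (lfunE (f2 x)).
Qed.

Lemma SformC b a (x y : V b) : Sform a x y = Sform a y x.
Proof. by apply: eq_bigr => I _; rewrite mulrAC. Qed.

Lemma SformW_Smap b a (x y : V b) :
  SformW a (Smap b a x) (Smap b a y) = Sform a x y.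
Proof.
have inv u : Smap b a ((Smap b a)^-1%VF (Smap b a u)) = Smap b a u.
  by rewrite limg_lfunVK // memv_img ?memvf.
by rewrite /SformW -SmapE inv SmapE SformC -SmapE inv SmapE SformC.
Qed.

End Arrangement.

(* Main.v *)
Require Import Defs.
From mathcomp Require Import all_boot all_order all_algebra.
From mathcomp Require Import reals.
From mathcomp Require Import complex.
From mathcomp Require Import ring.
Import GRing.Theory Num.Theory.
Local Open Scope ring_scope.

(** As no weight vanishes, x |-> S(x, _) is an isomorphism from V onto its
dual.  Hence W is the whole dual space, and as soon as K_j is symmetric for S
this isomorphism carries K_j to its dual operator ([dualop_Kop]).  What remains
are three facts about V itself: K_j is symmetric ([Sform_Kop]), it preserves
Sing V ([Kop_singular] with [SingVP]), and the K_j commute ([Kop_comm]).  The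
last one holds on all of V.

All three are read off from one formula.  For a basis A (an independent set of
k elements) and m outside A, let c = fundrel A m be the only linear relation
between the g_i that is supported on A + m and has c_m = 1; its support is the
only circuit C with m in C and C inside A + m, and c is proportional to lam C.
Divide x_I by the maximal minor of b on the rows of I: all the signs coming from
orderings disappear, because the minor and the flag F(H_I) change by the same
sign.  Multiply moreover by the product a_I of the weights.  In the coordinates
w(I) = a_I x_I / minor I so obtained, [wcoord_Kop] says that K_j acts by
  (K_j w)(A) = \sum_(m notin A) c_j / f(c) \sum_l a_l c_l w(A + m - l),
with c = fundrel A m and f(c) = \sum_i c_i z_i, which is nonzero since z avoids
Delta.

Commutation ([Kcoord_comm]).  In K_i K_j, the terms that bring the same m in
twice are symmetric in i and j.  In the other terms two distinct p and q
outside A are brought in.  Let c and d be their fundamental relations and put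
[s t] = c_s d_t - d_s c_t.  Replacing A by A + p - l replaces d by
d - (d_l / c_l) c, so every coefficient is a rational function of c, d, f(c) and
f(d).  After antisymmetrization in i and j, the orders (p, q) and (q, p)
together contribute
  [i j] / (f(c) f(d)) \sum_l \sum_t a_l a_t [l t] w(A + p + q - l - t),
which vanishes as [l t] is antisymmetric in l and t.

Singular vectors ([Kcoord_singular]).  The forms omega_I(z) are linearly
independent when z avoids Delta: clear denominators and evaluate at
the vertex where the hyperplanes of I meet ([omegas_free]).  Therefore x lies in
Sing V iff w(A) = \sum_(p notin A) (fundrel A p)_q w(A - q + p) for every basis A
and every q in A ([SingVP]).  When this relation is tested on K_j w, the terms
whose circuits contain two new elements cancel in pairs, and the others are
instances of the same relation for w. *)

Set Implicit Arguments.
Unset Strict Implicit.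

(** * Linear relations and maximal minors *)

Section Relations.
Context (F : fieldType) (n k : nat) (b : 'M[F]_(n, k)).
Implicit Types (A C : {set 'I_n}) (c d : 'I_n -> F).

Definition linrel c : Prop := \sum_i c i *: row i b = 0.
Definition supported A c : Prop := forall i, i \notin A -> c i = 0.

Lemma linrelB e c d : linrel c -> linrel d -> linrel (fun i => d i - e * c i).
Proof.
rewrite /linrel => rc rd.
rewrite (eq_bigr (fun i => d i *: row i b - e *: (c i *: row i b))) => [|i _].
  by rewrite sumrB -scaler_sumr rc rd scaler0 subr0.
by rewrite scalerBl scalerA.
Qed.

(** Phrasing independence by functions on all of 'I_n, rather than by families
indexed by an enumeration, lets relations on different sets be subtracted. *)
Lemma indepP A :
  reflect (forall c, supported A c -> linrel c -> forall i, c i = 0) (indep b A).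
Proof.
pose X := in_tuple [seq row j b | j <- enum A].
have szX : size (enum A) = size [seq row j b | j <- enum A] by rewrite size_map.
have sumE (u : 'I_n -> F) (x0 : 'I_n) :
    \sum_(i in A) u i *: row i b = \sum_(i < size [seq row j b | j <- enum A])
      u (nth x0 (enum A) i) *: X`_i.
  rewrite -big_enum (big_nth x0) big_mkord szX; apply: eq_bigr => i _ /=.
  by rewrite (nth_map x0) // szX.
rewrite /indep; apply: (iffP (@freeP _ _ _ X)) => [frX c sc rc i|indA u].
  have [iA|/sc//] := boolP (i \in A).
  have lt_i : (index i (enum A) < size [seq row j b | j <- enum A])%N.
    by rewrite -szX index_mem mem_enum.
  have := frX (fun r => c (nth i (enum A) r)) _ (Ordinal lt_i).
  rewrite /= nth_index ?mem_enum //; apply.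
  rewrite -sumE -[RHS]rc [RHS](bigID (mem A)) /= [X in _ + X]big1 ?addr0 // => l.
  by move/sc->; rewrite scale0r.
move=> /= u0 i; have x0 : 'I_n.
  have : (0 < size (enum A))%N by rewrite szX; apply: leq_ltn_trans (ltn_ord i).
  by case: (enum A).
pose c j := if j \in A then
  odflt 0 (omap u (insub (index j (enum A)))) else 0.
have cE (r : 'I_(size [seq row j b | j <- enum A])) : c (nth x0 (enum A) r) = u r.
  have rA : (r < size (enum A))%N by rewrite szX.
  by rewrite /c -mem_enum mem_nth // index_uniq ?enum_uniq // valK.
rewrite -cE; apply: indA => [j|].
  by rewrite /c => /negPf->.
rewrite /linrel (bigID (mem A)) /= [X in _ + X]big1 ?addr0 => [|j /negPf jA].
  by rewrite (sumE _ x0) -[RHS]u0; apply: eq_bigr => r _; rewrite cE.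
by rewrite /c jA scale0r.
Qed.

Definition selmx (s : seq 'I_n) : 'M[F]_(k, n) :=
  \matrix_(i, j) (onth s i == Some j)%:R.
Definition minor (s : seq 'I_n) : F := \det (selmx s *m b).

Lemma selmxE s x0 (i : 'I_k) j : size s = k ->
  selmx s i j = (nth x0 s i == j)%:R.
Proof.
by move=> sz; rewrite mxE onthE (nth_map x0) ?sz // (inj_eq Some_inj).
Qed.

Lemma selmx_mulE m (X : 'M[F]_(n, m)) s x0 (i : 'I_k) j : size s = k ->
  (selmx s *m X) i j = X (nth x0 s i) j.
Proof.
move=> sz; rewrite mxE (bigD1 (nth x0 s i)) //= (selmxE x0) // eqxx mul1r.
rewrite big1 ?addr0 // => l nel.
by rewrite (selmxE x0) // eq_sym (negPf nel) mul0r.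
Qed.

Lemma mul_selmx_nth m (X : 'M[F]_(m, k)) s x0 i (r : 'I_k) :
  size s = k -> uniq s -> (X *m selmx s) i (nth x0 s r) = X i r.
Proof.
move=> sz us; rewrite mxE (bigD1 r) //= (selmxE x0) // eqxx mulr1.
rewrite big1 ?addr0 // => j ne; rewrite (selmxE x0) //.
by rewrite nth_uniq ?sz // val_eqE (negPf ne) mulr0.
Qed.

Lemma mul_selmx_notin m (X : 'M[F]_(m, k)) s i j :
  j \notin s -> (X *m selmx s) i j = 0.
Proof.
move=> js; rewrite mxE big1 // => r _; rewrite mxE.
by rewrite (negPf (onthPn _ _)) ?mulr0.
Qed.

Definition is_basis A := (#|A| == k) && indep b A.

Lemma size_enum_basis A : is_basis A -> size (enum A) = k.
Proof. by rewrite -cardE; case/andP=> /eqP. Qed.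

Lemma minor_neq0 A : is_basis A -> minor (enum A) != 0.
Proof.
move=> bA; have sz := size_enum_basis bA; have /andP[_ /indepP indA] := bA.
apply/negP => /det0P[v v0].
rewrite mulmxA => vb0; case/negP: v0; apply/eqP/rowP => r.
have x0 : 'I_n.
  have : (0 < size (enum A))%N by rewrite sz; apply: leq_ltn_trans (ltn_ord r).
  by case: (enum A).
rewrite [RHS]mxE -(mul_selmx_nth v x0 0 r sz) ?enum_uniq //.
apply: (indA (fun i => (v *m selmx (enum A)) 0 i)) => [i iA|].
  by rewrite mul_selmx_notin // mem_enum.
by move: vb0; rewrite mulmx_sum_row.
Qed.

(** * Fundamental relations and basis exchange *)

Definition coordmx A : 'M[F]_n :=
  b *m invmx (selmx (enum A) *m b) *m selmx (enum A).

(** Row m of [coordmx A] holds the coordinates of g_m in the basis A, extended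
by 0 outside A. *)
Lemma coordmxK A : is_basis A -> coordmx A *m b = b.
Proof.
move=> bA; rewrite /coordmx -mulmxA mulmxKV // unitmxE unitfE.
exact: minor_neq0.
Qed.

(** This is g_m minus its expansion in the basis A, so that for m outside A it
is the relation carried by the fundamental circuit of m. *)
Definition fundrel A m (l : 'I_n) : F := (l == m)%:R - coordmx A m l.

Lemma linrel_fundrel A m : is_basis A -> linrel (fundrel A m).
Proof.
move=> bA; rewrite /linrel.
rewrite (eq_bigr (fun i => (i == m)%:R *: row i b - coordmx A m i *: row i b)).
  rewrite sumrB (bigD1 m) //= eqxx scale1r big1 ?addr0 => [|i /negPf->]; last first.
    by rewrite scale0r.
  apply/eqP; rewrite subr_eq0; apply/eqP.
  transitivity (row m (coordmx A *m b)); last first.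
    rewrite row_mul mulmx_sum_row; apply: eq_bigr => i _.
    by rewrite [row m _ 0 i]mxE.
  by rewrite coordmxK.
by move=> i _; rewrite scalerBl.
Qed.

Lemma fundrel_out A m : supported (m |: A) (fundrel A m).
Proof.
move=> i; rewrite !inE negb_or => /andP[/negPf im iA].
by rewrite /fundrel im mul_selmx_notin ?mem_enum // subr0.
Qed.

Lemma fundrel1 A m : m \notin A -> fundrel A m m = 1.
Proof. by move=> mA; rewrite /fundrel eqxx mul_selmx_notin ?mem_enum // subr0. Qed.

(** The difference of the two sides is a relation supported on A. *)
Lemma linrel_uniq A m c : is_basis A -> m \notin A ->
  supported (m |: A) c -> linrel c -> forall l, c l = c m * fundrel A m l.
Proof.
move=> bA mA sc rc l; apply/eqP; rewrite -subr_eq0; apply/eqP.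
have /andP[_ /indepP indA] := bA.
apply: (indA (fun i => c i - c m * fundrel A m i)).
  move=> i iA; have [->|nim] := eqVneq i m; first by rewrite fundrel1 // mulr1 subrr.
  by rewrite sc ?fundrel_out ?mulr0 ?subr0 // !inE negb_or nim.
by apply: linrelB => //; apply: linrel_fundrel.
Qed.

Definition swap A m l := (m |: A) :\ l.

Lemma swap_id A m : m \notin A -> swap A m m = A.
Proof. by move=> mA; rewrite /swap setU1K. Qed.

Lemma fundrel_neq0_in A m l : fundrel A m l != 0 -> l \in m |: A.
Proof. by apply: contraNT => lA; rewrite fundrel_out. Qed.

(** A relation supported on A + m - l is a multiple of [fundrel A m] that
vanishes at l, hence it is 0. *)
Lemma swap_basis A m l : is_basis A -> m \notin A -> fundrel A m l != 0 ->
  is_basis (swap A m l).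
Proof.
move=> bA mA nz; have lU := fundrel_neq0_in nz; have /andP[/eqP cA indA] := bA.
apply/andP; split.
  have := cardsD1 l (m |: A); rewrite lU cardsU1 mA cA /= => /eqP.
  by rewrite !add1n eqSS eq_sym.
apply/indepP => c sc rc i.
have scU : supported (m |: A) c.
  by move=> j jU; apply: sc; rewrite !inE negb_and -in_setU1 jU orbT.
have cE := linrel_uniq bA mA scU rc.
have : c l == 0 by rewrite sc // !inE eqxx.
by rewrite [c l]cE mulf_eq0 (negPf nz) orbF => /eqP cm; rewrite cE cm mul0r.
Qed.

(** A + m and (A + m - l) + l are the same set, so the two relations can differ
only by their normalization. *)
Lemma fundrel_swap_back A m l : is_basis A -> m \notin A -> fundrel A m l != 0 ->
  forall t, fundrel (swap A m l) l t = fundrel A m t / fundrel A m l.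
Proof.
move=> bA mA nz t; have lU := fundrel_neq0_in nz.
rewrite (@linrel_uniq _ l (fundrel A m) (swap_basis bA mA nz)).
  by rewrite (mulrC (fundrel A m l)) mulfK.
- by rewrite !inE eqxx.
- by rewrite /swap setD1K //; apply: fundrel_out.
- exact: linrel_fundrel.
Qed.

(** The pivot rule: this combination of the two old relations is the one that
vanishes at l and keeps the value 1 at q. *)
Lemma fundrel_swap A p q l : is_basis A -> p \notin A -> q \notin A -> p != q ->
    fundrel A p l != 0 -> forall t,
  fundrel (swap A p l) q t = fundrel A q t - fundrel A q l / fundrel A p l * fundrel A p t.
Proof.
move=> bA pA qA npq nz t; have lU := fundrel_neq0_in nz.
have pq0 : fundrel A p q = 0 by rewrite fundrel_out // !inE negb_or eq_sym npq.
pose c t := fundrel A q t - fundrel A q l / fundrel A p l * fundrel A p t.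
rewrite -[RHS]/(c t).
have cq : c q = 1 by rewrite /c fundrel1 // pq0 mulr0 subr0.
rewrite (@linrel_uniq (swap A p l) q c) ?cq ?mul1r //.
- exact: swap_basis.
- by rewrite !inE (eq_sym q p) (negPf npq) (negPf qA) andbF.
- move=> i; rewrite !inE !negb_or => /andP[niq].
  rewrite negb_and negbK negb_or => /orP[/eqP->|/andP[nip iA]].
    by rewrite /c divfK // subrr.
  have out m : i != m -> fundrel A m i = 0.
    by move=> nim; rewrite fundrel_out // !inE negb_or nim.
  by rewrite /c !out // mulr0 subr0.
- by apply: (@linrelB _ (fundrel A p) (fundrel A q)); apply: linrel_fundrel.
Qed.

End Relations.

Section Residue.
Context (F : fieldType) (n : nat) (z : 'I_n -> F).
Implicit Types (c d : 'I_n -> F).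

(** For c = [lam C] this is f_C(z), and for c = [fundrel b A m] it is the value
of f_m at the vertex where the hyperplanes H_i, i in A, meet. *)
Definition relval c : F := \sum_i c i * z i.
(** The coefficient of dz_j in dlog f, where f is the linear form with
coefficients c; it depends on c only up to a scalar. *)
Definition dlogcoef (j : 'I_n) c : F := c j / relval c.

Lemma eq_relval c d : c =1 d -> relval c = relval d.
Proof. by move=> e; rewrite /relval; under eq_bigr do rewrite e. Qed.

Lemma dlogcoef_ext j c d : c =1 d -> dlogcoef j c = dlogcoef j d.
Proof. by move=> e; rewrite /dlogcoef e (eq_relval e). Qed.

Lemma relvalB e c d : relval (fun t => d t - e * c t) = relval d - e * relval c.
Proof.
rewrite /relval mulr_sumr -sumrB; apply: eq_bigr => i _.
by rewrite mulrBl mulrA.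
Qed.

Lemma dlogcoef_scale j e c d :
  e != 0 -> (forall t, d t = c t / e) -> dlogcoef j d = dlogcoef j c.
Proof.
move=> e0 dE; rewrite /dlogcoef /relval dE.
have -> : \sum_i d i * z i = (\sum_i c i * z i) / e.
  by rewrite mulr_suml; apply: eq_bigr => i _; rewrite dE mulrAC.
by rewrite invf_div mulrA divfK.
Qed.

End Residue.

(** * Exchange operators on functions of a basis *)

Lemma sum_antisym (F : numFieldType) (I : finType) (X : I -> I -> F) :
  (forall i j, X i j = - X j i) -> \sum_i \sum_j X i j = 0.
Proof.
move=> anti; apply/eqP; rewrite -eqNr {2}exchange_big -sumrN; apply/eqP.
apply: eq_bigr => i _; rewrite -sumrN; apply: eq_bigr => j _.
by rewrite [RHS]anti.
Qed.

Section ExchangeCoordinates.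
Context (F : numFieldType) (n k : nat) (b : 'M[F]_(n, k)).
Context (a z : 'I_n -> F).
Implicit Types (A : {set 'I_n}) (c d : 'I_n -> F) (w : {set 'I_n} -> F).
Local Notation fundrel := (fundrel b).

Local Notation relval := (relval z).
Local Notation dlogcoef := (dlogcoef z).

Hypothesis generic : forall A m, is_basis b A -> m \notin A -> relval (fundrel A m) != 0.

(** Up to a scalar this depends only on the set A + m, see
[exchange_sum_swap_back]. *)
Definition exchange_sum w A m : F := \sum_l a l * fundrel A m l * w (swap A m l).

(** K_j in the coordinates [wcoord]. *)
Definition Kcoord (j : 'I_n) w A : F :=
  \sum_(m | m \notin A) dlogcoef j (fundrel A m) * exchange_sum w A m.

(** The elements that can enter A + p - l are l itself, which undoes the first
exchange up to the choice of the element that leaves, and those outside A + p. *)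
Lemma sum_swap_out A p l (G : 'I_n -> F) : p \notin A -> l \in p |: A ->
  \sum_(q | q \notin swap A p l) G q = G l + \sum_(q | (q \notin A) && (q != p)) G q.
Proof.
move=> pA lU; rewrite (bigD1 l) /= ?inE ?eqxx //; congr (_ + _).
apply: eq_bigl => q; rewrite !inE negb_and negbK negb_or.
have [->|nql] /= := eqVneq q l; last by rewrite andbT andbC.
by move: lU; rewrite !inE; case: eqP => [_|_ /= ->]; rewrite ?andbF.
Qed.

Lemma exchange_sum_swap_back w A m l : is_basis b A -> m \notin A -> fundrel A m l != 0 ->
  exchange_sum w (swap A m l) l = exchange_sum w A m / fundrel A m l.
Proof.
move=> bA mA nz; rewrite /exchange_sum mulr_suml; apply: eq_bigr => t _.
rewrite fundrel_swap_back // /swap setD1K; last exact: fundrel_neq0_in nz.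
by rewrite mulrA mulrAC.
Qed.

Definition swap2 A p q l t := ((q |: (p |: A)) :\ l) :\ t.

Lemma swap_swap A p q l t : l != q -> swap (swap A p l) q t = swap2 A p q l t.
Proof.
move=> nlq; rewrite /swap /swap2; congr (_ :\ t); apply/setP => i; rewrite !inE.
by case: (eqVneq i q) => [->|]; rewrite ?(eq_sym q l) ?nlq.
Qed.

Lemma swap2_add_sym A p q l t : swap2 A p q l t = swap2 A q p l t.
Proof. by rewrite /swap2 setUCA. Qed.

Lemma swap2_rem_sym A p q l t : swap2 A p q l t = swap2 A p q t l.
Proof. by apply/setP => i; rewrite !inE andbCA. Qed.

(** The first sum collects the terms where the element that has just left comes
back: both exchanges then take place inside A + p and use the same circuit.  In
the second sum two distinct elements p and q enter, and l and t leave. *)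
Lemma Kcoord_comp i j w A : is_basis b A ->
  Kcoord i (Kcoord j w) A =
    \sum_(p | p \notin A) \sum_(l | fundrel A p l != 0)
       a l * dlogcoef i (fundrel A p) * dlogcoef j (fundrel A p) * exchange_sum w A p +
    \sum_(p | p \notin A) \sum_(q | (q \notin A) && (q != p))
      \sum_l \sum_t (a l * a t * w (swap2 A p q l t)) *
         (if fundrel A p l == 0 then 0 else
          dlogcoef i (fundrel A p) * fundrel A p l *
          (dlogcoef j (fun t => fundrel A q t - fundrel A q l / fundrel A p l * fundrel A p t) *
          (fundrel A q t - fundrel A q l / fundrel A p l * fundrel A p t))).
Proof.
move=> bA; rewrite -big_split; apply: eq_bigr => p pA /=.
rewrite {1}/exchange_sum mulr_sumr exchange_big /= (bigID (fun l => fundrel A p l != 0)) /=.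
rewrite [X in _ + X]big1 ?addr0 => [|l /negPn/eqP->]; last by rewrite !(mulr0, mul0r).
rewrite [X in _ = _ + X](bigID (fun l => fundrel A p l != 0)) /=.
rewrite [X in _ = _ + (_ + X)]big1 ?addr0 => [|l /negPn /eqP ->]; last first.
  by rewrite big1 // => q _; rewrite big1 // => t _; rewrite eqxx mulr0.
rewrite -big_split; apply: eq_bigr => l nz /=.
rewrite /Kcoord sum_swap_out //; last exact: fundrel_neq0_in nz.
rewrite exchange_sum_swap_back // (dlogcoef_scale z j nz (fundrel_swap_back bA pA nz)).
rewrite [_ * (_ + \sum_(_ | _) _)]mulrDr [_ * (_ + _ * \sum_(_ | _) _)]mulrDr.
congr (_ + _); first by field.
rewrite !mulr_sumr; apply: eq_bigr => q /andP[qA nqp].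
rewrite /exchange_sum !mulr_sumr; apply: eq_bigr => t _.
rewrite (negPf nz) swap_swap; last first.
  apply: contraNneq nz => ->; rewrite fundrel_out // !inE negb_or.
  by rewrite nqp.
rewrite (dlogcoef_ext z j (fundrel_swap bA pA qA _ nz)) 1?eq_sym // fundrel_swap // 1?eq_sym //.
by ring.
Qed.

(** The coefficient of the double exchange that brings in p, removes l, brings
in q and removes t.  The letters c and d stand for the fundamental relations of
p and q, indexed by i, l, t, j, and f and g for their values at z. *)
Definition double_exchange (ci cl ct cj di dl dt dj f g : F) : F :=
  if cl == 0 then 0 else
  ci / f * cl * ((dj - dl / cl * cj) / (g - dl / cl * f) * (dt - dl / cl * ct)).

(** The denominators cl * g - dl * f of the two orders (p, q) and (q, p) are
opposite and cancel, which is what makes the sum antisymmetric in l and t. *)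
Lemma double_exchange_antisym (ci cj cl ct di dj dl dt f g : F) :
    f != 0 -> g != 0 ->
    (cl != 0 -> g - dl / cl * f != 0) -> (dl != 0 -> f - cl / dl * g != 0) ->
  (double_exchange ci cl ct cj di dl dt dj f g -
     double_exchange cj cl ct ci dj dl dt di f g) +
  (double_exchange di dl dt dj ci cl ct cj g f -
     double_exchange dj dl dt di cj cl ct ci g f) =
  (ci * dj - di * cj) * (cl * dt - dl * ct) / (f * g).
Proof.
move=> f0 g0 nc nd; rewrite /double_exchange.
have [c0|c0] := eqVneq cl 0; have [d0|d0] := eqVneq dl 0.
- by rewrite c0 d0; field; rewrite f0 g0.
- by rewrite c0; field; rewrite f0 g0 d0.
- by rewrite d0; field; rewrite f0 g0 c0.
have n0 : cl * g - dl * f != 0.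
  apply: contraNneq (nc c0) => e; rewrite -(mulrI_eq0 _ (mulfI c0)) mulrBr.
  by rewrite mulrA mulrCA mulfV ?mulr1 // e.
have n1 : dl * f - cl * g != 0 by rewrite -oppr_eq0 opprB.
by field; rewrite f0 g0 c0 d0 (mulrC f) (mulrC g) n0 n1.
Qed.

Theorem Kcoord_comm i j w A : is_basis b A ->
  Kcoord i (Kcoord j w) A = Kcoord j (Kcoord i w) A.
Proof.
move=> bA; apply: subr0_eq; rewrite !Kcoord_comp // opprD addrACA -!sumrB.
rewrite [X in X + _]big1 ?add0r => [|p pA]; last first.
  by rewrite -sumrB big1 // => l _; rewrite [a l * dlogcoef j _ * _]mulrAC subrr.
pose pvt i j p q l t :=
  double_exchange (fundrel A p i) (fundrel A p l) (fundrel A p t) (fundrel A p j)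
    (fundrel A q i) (fundrel A q l) (fundrel A q t) (fundrel A q j)
    (relval (fundrel A p)) (relval (fundrel A q)).
(* X p q is antisymmetric in p and q, but only after summing over l and t. *)
pose X p q := if [&& p \notin A, q \notin A & q != p] then
  \sum_l \sum_t (a l * a t * w (swap2 A p q l t)) * (pvt i j p q l t - pvt j i p q l t) else 0.
transitivity (\sum_p \sum_q X p q); last first.
  apply: sum_antisym => p q; apply/eqP; rewrite -addr_eq0 /X andbCA (eq_sym p q).
  case: ifP => [/and3P[qA pA npq]|_]; last by rewrite addr0.
  (* In the notation of 2x2 minors, Z is [i j] [l t] / (f(c) f(d)). *)
  pose Z l t := (fundrel A p i * fundrel A q j - fundrel A q i * fundrel A p j) *
    (fundrel A p l * fundrel A q t - fundrel A q l * fundrel A p t) /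
    (relval (fundrel A p) * relval (fundrel A q)).
  rewrite -big_split /=; apply/eqP.
  rewrite (eq_bigr (fun l => \sum_t a l * a t * w (swap2 A p q l t) * Z l t)).
    apply: sum_antisym => l t; rewrite swap2_rem_sym (mulrC (a l)) -mulrN; congr (_ * _).
    by rewrite /Z; ring.
  move=> l _; rewrite -big_split /=; apply: eq_bigr => t _.
  rewrite (swap2_add_sym A q p) -mulrDr; congr (_ * _).
  apply: double_exchange_antisym; rewrite ?generic //.
    move=> nz; rewrite -relvalB.
    have npq' : p != q by rewrite eq_sym.
    rewrite -(eq_relval z (fundrel_swap bA pA qA npq' nz)).
    apply: generic; first exact: swap_basis.
    by rewrite !inE (negPf qA) (negPf npq) andbF.
  move=> nz; rewrite -relvalB -(eq_relval z (fundrel_swap bA qA pA npq nz)).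
  apply: generic; first exact: swap_basis.
  by rewrite !inE (negPf pA) (eq_sym p q) (negPf npq) andbF.
rewrite [LHS]big_mkcond; apply: eq_bigr => p _.
case: ifP => pA; last by rewrite big1 // => q _; rewrite /X pA.
rewrite -sumrB [LHS]big_mkcond; apply: eq_bigr => q _; rewrite /X pA /=.
case: ifP => // _; rewrite -sumrB; apply: eq_bigr => l _.
rewrite -sumrB; apply: eq_bigr => t _; rewrite -mulrBr; congr (_ * (_ - _)).
  by rewrite /pvt /double_exchange /dlogcoef relvalB.
by rewrite /pvt /double_exchange /dlogcoef relvalB.
Qed.

(** The defining equations of Sing V in the coordinates [wcoord], see
[flagval_sum] for how they arise. *)
Definition singular w : Prop := forall A q, is_basis b A -> q \in A ->
  w A = \sum_(p | p \notin A) fundrel A p q * w (swap A p q).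

(** The equation of w at the basis A + m - l and the element q: since
[fundrel A m] vanishes at q, the pivot rule leaves the coefficients
[fundrel A p q] unchanged. *)
Lemma singular_swap w A m q l : singular w -> is_basis b A -> m \notin A ->
    q \in A -> fundrel A m q = 0 -> fundrel A m l != 0 ->
  \sum_(p | (p \notin A) && (p != m)) fundrel A p q * w (swap2 A p m q l) =
  w (swap A m l).
Proof.
move=> sw bA mA qA mq0 nz; have lU := fundrel_neq0_in nz.
have nql : q != l by apply: contraNneq nz => <-; rewrite mq0.
rewrite [RHS](sw _ q); first last.
- by rewrite !inE nql qA orbT.
- exact: swap_basis.
rewrite sum_swap_out // fundrel_swap_back // mq0 !mul0r add0r.
apply: eq_bigr => p /andP[pA npm]; have nmp : m != p by rewrite eq_sym.
rewrite (fundrel_swap bA mA pA nmp nz) mq0 mulr0 subr0.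
rewrite swap_swap 1?swap2_add_sym 1?swap2_rem_sym //.
by apply: contraNneq nz => ->; rewrite fundrel_out // !inE negb_or npm.
Qed.

(** Write c and d for the fundamental relations of p and m.  Exchanging q for p
and then bringing m in involves the relation E = c_q d - d_q c.  It changes sign
when p and m are interchanged while [dlogcoef] ignores scalars, so the terms with
c_q and d_q both nonzero cancel in pairs.  If d_q = 0 then E is proportional to
d, and summing over p is an instance of [singular_swap]. *)
Theorem Kcoord_singular j w : singular w -> singular (Kcoord j w).
Proof.
move=> sw A q bA qA.
(* E p m is the combination of the relations of p and m that vanishes at q. *)
pose E p m t := fundrel A p q * fundrel A m t - fundrel A m q * fundrel A p t.
pose Z p m := dlogcoef j (E p m) * \sum_l a l * E p m l * w (swap2 A p m q l).
have ZE p m : p \notin A -> m \notin A -> m != p -> fundrel A p q != 0 ->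
    fundrel A p q * (dlogcoef j (fundrel (swap A p q) m) * exchange_sum w (swap A p q) m) = Z p m.
  move=> pA mA nmp nz; have npm : p != m by rewrite eq_sym.
  have rE t : fundrel (swap A p q) m t = E p m t / fundrel A p q.
    by rewrite fundrel_swap // /E; field.
  rewrite (dlogcoef_scale z j nz rE) mulrCA; congr (_ * _).
  rewrite /exchange_sum mulr_sumr; apply: eq_bigr => l _.
  rewrite rE swap_swap; first by field.
  by apply: contraNneq mA => <-.
(* The first summand is the term where q comes back. *)
rewrite (eq_bigr (fun p =>
    (if fundrel A p q == 0 then 0
     else dlogcoef j (fundrel A p) * exchange_sum w A p) +
    \sum_(m | (m \notin A) && (m != p))
      if fundrel A p q == 0 then 0 else Z p m)); last first.
  move=> p pA; case: eqP => [->|/eqP nz].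
    by rewrite mul0r big1 ?addr0.
  have qU := fundrel_neq0_in nz.
  rewrite /Kcoord sum_swap_out // (dlogcoef_scale z j nz (fundrel_swap_back bA pA nz)).
  rewrite exchange_sum_swap_back // mulrDr; congr (_ + _); first by field.
  by rewrite mulr_sumr; apply: eq_bigr => m /andP[mA nmp]; rewrite ZE.
rewrite big_split /=.
pose X p m := if [&& p \notin A, m \notin A, m != p, fundrel A p q != 0 & fundrel A m q != 0]
  then Z p m else 0.
(* E m p = - E p m. *)
have X0 : \sum_p \sum_m X p m = 0.
  apply: sum_antisym => p m; rewrite /X.
  have -> : [&& m \notin A, p \notin A, p != m, fundrel A m q != 0 & fundrel A p q != 0]
     = [&& p \notin A, m \notin A, m != p, fundrel A p q != 0 & fundrel A m q != 0].
    by rewrite andbCA (eq_sym p m) (andbC (fundrel A m q != 0)).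
  case: ifP => _; last by rewrite oppr0.
  have N1 : (-1 : F) != 0 by rewrite oppr_eq0 oner_eq0.
  rewrite /Z (@dlogcoef_scale _ _ z j (-1) (E m p)) // => [|t]; last first.
    by rewrite invrN1 mulrN1 /E opprB.
  rewrite -mulrN -sumrN; congr (_ * _); apply: eq_bigr => l _.
  by rewrite (swap2_add_sym A m p) /E; ring.
(* What survives are the m whose circuit avoids q; they are the terms of
   Kcoord j w A that the first summand misses. *)
have -> : \sum_(p | p \notin A) \sum_(m | (m \notin A) && (m != p))
     (if fundrel A p q == 0 then 0 else Z p m) =
  \sum_(m | m \notin A) if fundrel A m q == 0 then
    dlogcoef j (fundrel A m) * exchange_sum w A m else 0.
  pose Y p m := if [&& p \notin A, m \notin A, m != p & fundrel A m q == 0]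
    then (if fundrel A p q == 0 then 0 else Z p m) else 0.
  rewrite -[RHS]add0r -[V in _ = V + _]X0; transitivity (\sum_p \sum_m (X p m + Y p m)).
    rewrite [LHS]big_mkcond; apply: eq_bigr => p _.
    case: ifP => pA; last by rewrite big1 // => m _; rewrite /X /Y pA addr0.
    rewrite [LHS]big_mkcond; apply: eq_bigr => m _; rewrite /X /Y pA /=.
    case: (m \notin A); case: (m != p) => //=; rewrite ?addr0 //.
    by case: (fundrel A p q == 0); case: (fundrel A m q == 0); rewrite ?addr0 ?add0r.
  under eq_bigr do rewrite big_split; rewrite big_split /=; congr (_ + _).
  rewrite exchange_big [RHS]big_mkcond; apply: eq_bigr => m _ /=.
  case: ifP => mA; last by rewrite big1 // => p _; rewrite /Y mA andbF.
  have [mq0|mq0] := eqVneq (fundrel A m q) 0; last first.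
    by rewrite big1 // => p _; rewrite /Y (negPf mq0) !andbF.
  transitivity (dlogcoef j (fundrel A m) * \sum_(p | (p \notin A) && (p != m))
      fundrel A p q * \sum_l a l * fundrel A m l * w (swap2 A p m q l)).
    rewrite mulr_sumr [RHS]big_mkcond; apply: eq_bigr => p _.
    rewrite /Y mA mq0 eqxx andbT (eq_sym m p) /=; case: ifP => // _.
    case: eqP => [->|/eqP nz]; first by rewrite mul0r mulr0.
    have EE t : E p m t = fundrel A p q * fundrel A m t by rewrite /E mq0 mul0r subr0.
    have nzV : (fundrel A p q)^-1 != 0 by rewrite invr_eq0.
    rewrite /Z (@dlogcoef_scale _ _ z j _ (fundrel A m) _ nzV) => [|t]; last first.
      by rewrite invrK mulrC EE.
    congr (_ * _); rewrite mulr_sumr; apply: eq_bigr => l _.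
    by rewrite EE mulrCA !mulrA.
  congr (_ * _); under eq_bigr do rewrite mulr_sumr.
  rewrite exchange_big; apply: eq_bigr => l _ /=.
  have [->|nz] := eqVneq (fundrel A m l) 0.
    by rewrite mulr0 mul0r big1 // => p _; rewrite mul0r mulr0.
  rewrite -(singular_swap sw bA mA qA mq0 nz) mulr_sumr; apply: eq_bigr => p _.
  by rewrite swap2_add_sym mulrCA.
rewrite -big_split; apply: eq_bigr => p pA /=.
by case: ifP; rewrite ?add0r ?addr0.
Qed.
End ExchangeCoordinates.

(** * Determinantal form of the flags *)

Section Minors.
Context (F : fieldType) (n k : nat) (b : 'M[F]_(n, k)).
Implicit Types (A C : {set 'I_n}) (s : seq 'I_n) (c d : 'I_n -> F).
Local Notation fundrel := (fundrel b).
Local Notation minor := (minor b).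

Lemma fundrel_in A i : is_basis b A -> i \in A -> fundrel A i =1 fun=> 0.
Proof.
move=> bA iA; have /andP[_ /indepP indA] := bA.
apply: indA; last exact: linrel_fundrel.
move=> j jA; rewrite fundrel_out // !inE negb_or jA andbT.
by apply: contraNneq jA => ->.
Qed.

(** The cofactors of row r do not see that row, so they are those of 1. *)
Lemma det_row1 m (E : 'M[F]_m) r :
  (forall i j, i != r -> E i j = (i == j)%:R) -> \det E = E r r.
Proof.
move=> Eid; rewrite (expand_det_row _ r).
have cofE j : cofactor E r j = (r == j)%:R.
  have -> : cofactor E r j = \adj (1%:M : 'M[F]_m) j r.
    rewrite mxE /cofactor; congr (_ * \det _); apply/matrixP => u v.
    by rewrite !mxE Eid // eq_sym neq_lift.
  by rewrite adj1 mxE eq_sym.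
rewrite (bigD1 r) //= cofE eqxx mulr1 big1 ?addr0 // => j nj.
by rewrite cofE eq_sym (negPf nj) mulr0.
Qed.

(** Cramer's rule. *)
Lemma minor_sub1 A s m l : is_basis b A -> perm_eq s (enum A) ->
    l \in A -> m \notin A ->
  minor (map (sub1 l m) s) = - fundrel A m l * minor s.
Proof.
move=> bA pA lA mA; have sz : size s = k by rewrite (perm_size pA) (size_enum_basis bA).
have us : uniq s by rewrite (perm_uniq pA) enum_uniq.
have memA x : (x \in s) = (x \in A) by rewrite (perm_mem pA) mem_enum.
have ls : l \in s by rewrite memA.
have lt_r : (index l s < k)%N by rewrite -sz index_mem.
set s' := map _ _; have sz' : size s' = k by rewrite size_map.
(* E expresses the rows of s' in those of s; it is the identity except in the
   row of l, where m has replaced l. *)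
pose E := \matrix_(i < k, j < k) coordmx b A (nth l s' i) (nth l s j).
have EM : selmx F k s' *m b = E *m (selmx F k s *m b).
  rewrite -{1}(coordmxK bA) mulmxA [E *m _]mulmxA; congr (_ *m b); apply/matrixP => i j.
  rewrite (selmx_mulE _ l) //; have [js|js] := boolP (j \in s); last first.
    by rewrite !mul_selmx_notin // -?memA ?mem_enum // -memA.
  have lt_j : (index j s < k)%N by rewrite -sz index_mem.
  have := mul_selmx_nth E l i (Ordinal lt_j) sz us.
  by rewrite /= nth_index // => ->; rewrite [RHS]mxE /= nth_index.
have cE i j : i \in A -> coordmx b A i j = (i == j)%:R.
  by move=> iA; have /eqP := fundrel_in bA iA j; rewrite subr_eq0 (eq_sym j i) => /eqP ->.
rewrite /minor EM det_mulmx; congr (_ * _).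
rewrite (det_row1 (r := Ordinal lt_r)) => [|i j ni].
  rewrite mxE /= (nth_map l) ?index_mem // nth_index // /sub1 eqxx.
  have -> : fundrel A m l = 0 - coordmx b A m l.
    by rewrite /fundrel; case: eqP mA => [<-|]; rewrite ?lA.
  by rewrite sub0r opprK.
rewrite mxE (nth_map l) ?sz // /sub1.
have nil : nth l s i != l.
  by apply: contraNneq ni => e; rewrite -val_eqE /= -e index_uniq ?sz.
rewrite (negPf nil) cE -?memA ?mem_nth ?sz //.
by rewrite nth_uniq ?sz.
Qed.

Lemma minor_basis s : size s = k -> minor s != 0 ->
  uniq s /\ is_basis b [set x in s].
Proof.
move=> sz nz.
have us : uniq s.
  apply: contraNT nz => nus; have x0 : 'I_n by case: s nus {sz} => [|x s] //.
  have [i [j [lt_ij lt_j eij]]] := uniqPn x0 nus; rewrite sz in lt_j.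
  apply/eqP; apply: (@determinant_alternate _ _ _ (Ordinal (ltn_trans lt_ij lt_j))
    (Ordinal lt_j)).
    by rewrite -val_eqE /= neq_ltn lt_ij.
  by move=> t; rewrite !(selmx_mulE _ x0) //= eij.
split=> //; apply/andP; split; first by rewrite cardsE (card_uniqP us) sz.
apply/indepP => c sc rc i; have [iA|/sc//] := boolP (i \in [set x in s]).
have is_ : i \in s by rewrite inE in iA.
have lt_i : (index i s < k)%N by rewrite -sz index_mem.
(* The coefficients along s form a row vector killed by the matrix of s. *)
pose v : 'rV[F]_k := \row_r c (nth i s r).
have : v == 0.
  apply: contraNT nz => v0; apply/det0P; exists v => //.
  rewrite mulmx_sum_row.
  transitivity (\sum_(x <- s) c x *: row x b).
    rewrite (big_nth i) big_mkord sz; apply: eq_bigr => r _.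
    rewrite mxE; congr (_ *: _); apply/rowP => t.
    by rewrite !mxE -(selmx_mulE b i r t sz) mxE.
  rewrite big_uniq //= -[RHS]rc [RHS](bigID (mem s)) /= [X in _ = _ + X]big1 ?addr0 //.
  by move=> x xs; rewrite sc ?scale0r // inE.
by move=> /eqP/rowP/(_ (Ordinal lt_i)); rewrite !mxE /= nth_index.
Qed.

Lemma kindep_basis (I : kindep b) : is_basis b (val I).
Proof. exact: (valP I). Qed.

(** If all of s lies in I, the matrix defining [Fflag b s I] expresses the rows
of b at s in terms of those at I; multiplicativity of the determinant gives the
quotient of minors. *)
Lemma FflagE s (I : kindep b) : size s = k ->
  Fflag b s I = ([set x in s] == val I)%:R * (minor s / minor (enum (val I))).
Proof.
move=> sz; have bI := kindep_basis I; have DI := minor_neq0 bI.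
have szI := size_kindep I.
have key : all (mem (val I)) s -> Fflag b s I = minor s / minor (enum (val I)).
  move=> /allP sI; apply: (mulIf DI); rewrite divfK // ffunE -det_mulmx.
  congr (\det _); rewrite mulmxA; congr (_ *m b).
  apply/matrixP => i j; have x0 := j.
  have siI : nth j s i \in enum (val I) by rewrite mem_enum; apply: sI; rewrite mem_nth ?sz.
  have lt_r : (index (nth j s i) (enum (val I)) < k)%N by rewrite -index_mem szI in siI.
  have on t (lt : (t < size s)%N) : onth s t = Some (nth j s t).
    by rewrite onthE (nth_map j).
  have onI t (lt : (t < k)%N) : onth (enum (val I)) t = Some (nth j (enum (val I)) t).
    by rewrite onthE (nth_map j) ?szI.
  rewrite mxE (bigD1 (Ordinal lt_r)) //= !mxE /= on ?sz // onI // nth_index // eqxx mul1r.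
  rewrite big1 ?addr0 // => r nr; rewrite !mxE on ?sz // onI // (inj_eq Some_inj).
  case: eqP => [e|]; rewrite ?mul0r //.
  by case/eqP: nr; apply: val_inj; rewrite /= e index_uniq ?enum_uniq ?szI.
have nkey : ~~ all (mem (val I)) s -> Fflag b s I = 0.
  case/allPn => x xs xI; rewrite ffunE.
  have lt_i : (index x s < k)%N by rewrite -sz index_mem.
  rewrite (expand_det_row _ (Ordinal lt_i)) big1 // => r _; rewrite mxE /=.
  rewrite onthE (nth_map x) ?sz // nth_index // eq_sym (negPf (onthPn _ _)) ?mul0r //.
  by rewrite mem_enum.
have [m0|nz] := eqVneq (minor s) 0.
  rewrite m0 mul0r mulr0; case: (boolP (all (mem (val I)) s)) => [/key->|/nkey//].
  by rewrite m0 mul0r.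
have [us /andP[/eqP cs _]] := minor_basis sz nz.
have -> : ([set x in s] == val I) = all (mem (val I)) s.
  have /andP[/eqP cI _] := bI.
  rewrite eqEcard cs cI leqnn andbT; apply/subsetP/allP => sI x xs; apply: sI => //.
    by rewrite inE.
  by rewrite inE in xs.
by case: (boolP (all (mem (val I)) s)) => [/key->|/nkey->]; rewrite ?mul1r ?mul0r.
Qed.

(** Only squares of minors are compared, which avoids following the signs of
reorderings. *)
Lemma minor_perm_sqr s A : is_basis b A -> perm_eq s (enum A) ->
  minor s ^+ 2 = minor (enum A) ^+ 2.
Proof.
move=> bA pA; pose I : kindep b := Sub A bA.
have DI := minor_neq0 bA.
have sz : size s = k by rewrite (perm_size pA) (size_enum_basis bA).
have [e /(_ id)] := Fflag_perm b (size_kindep I) pA.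
rewrite !map_id Fflag_enum => /ffunP/(_ I); rewrite FflagE // !ffunE eqxx.
have -> : [set x in s] = val I.
  by apply/setP => x; rewrite inE (perm_mem pA) mem_enum.
rewrite eqxx mul1r => /(canRL (divfK DI)) ->.
by rewrite exprMn; case: e; rewrite /= /GRing.scale /= ?expr0 ?expr1 mulr1 ?sqrrN
  expr1n mul1r.
Qed.

Lemma swap_sub1 A m l : l \in A -> m \notin A ->
  [set x in map (sub1 l m) (enum A)] = swap A m l.
Proof.
move=> lA mA; have nml : m != l by apply: contraNneq mA => ->.
apply/setP => x; rewrite !inE; apply/mapP/andP.
  move=> [y]; rewrite mem_enum /sub1 => yA ->.
  by case: (eqVneq y l) => [|->]; rewrite ?nml ?eqxx ?yA ?orbT.
move=> [nxl /predU1P[->|xA]].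
  by exists l; rewrite ?mem_enum // /sub1 eqxx.
by exists x; rewrite ?mem_enum // /sub1 (negPf nxl).
Qed.

(** The identity that makes the matrix of L_C symmetric after rescaling. *)
Lemma minor_swap_sqr A m l : is_basis b A -> m \notin A -> fundrel A m l != 0 ->
  minor (enum (swap A m l)) ^+ 2 = (fundrel A m l * minor (enum A)) ^+ 2.
Proof.
move=> bA mA nz; have [->|nlm] := eqVneq l m; first by rewrite swap_id // fundrel1 // mul1r.
have lA : l \in A by move: (fundrel_neq0_in nz); rewrite in_setU1 (negPf nlm).
have sE : [set x in map (sub1 l m) (enum A)] = swap A m l := swap_sub1 lA mA.
have mE := minor_sub1 bA (perm_refl _) lA mA.
have sz : size (map (sub1 l m) (enum A)) = k by rewrite size_map (size_enum_basis bA).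
have m0 : minor (map (sub1 l m) (enum A)) != 0.
  by rewrite mE mulf_neq0 ?oppr_eq0 // minor_neq0.
have [us _] := minor_basis sz m0.
rewrite -(@minor_perm_sqr (map (sub1 l m) (enum A))) ?swap_basis //.
  by rewrite mE mulNr sqrrN.
by apply: uniq_perm; rewrite ?enum_uniq // => x; rewrite mem_enum -sE inE.
Qed.

End Minors.

(** * Fundamental circuits and the matrix of K_j *)

Section FundamentalCircuit.
Context (F : fieldType) (n k : nat) (b : 'M[F]_(n, k)).
Implicit Types (A C D : {set 'I_n}).

Definition fcircuit A m : {set 'I_n} := [set l | fundrel b A m l != 0].

Lemma fcircuit_sub A m D : is_basis b A -> m \notin A ->
  D \proper fcircuit A m -> indep b D.
Proof.
move=> bA mA /properP[sD [i iC iD]]; apply/indepP => c sc rc l.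
have cE : forall l, c l = c m * fundrel b A m l.
  apply: linrel_uniq => // j jU; apply: sc; apply: contra jU => /(subsetP sD).
  by rewrite inE; apply: fundrel_neq0_in.
move: iC; rewrite inE => nz; have := cE i; rewrite sc // => /esym/eqP.
by rewrite mulf_eq0 (negPf nz) orbF => /eqP cm; rewrite cE cm mul0r.
Qed.

Lemma fcircuit_dep A m : is_basis b A -> m \notin A -> ~~ indep b (fcircuit A m).
Proof.
move=> bA mA; apply/negP => /indepP/(_ (fundrel b A m)) H.
have sup : supported (fcircuit A m) (fundrel b A m).
  by move=> i; rewrite inE negbK => /eqP.
by have /eqP := H sup (linrel_fundrel m bA) m; rewrite fundrel1 // oner_eq0.
Qed.

Lemma fcircuitP A m : is_basis b A -> m \notin A -> circuit b (fcircuit A m).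
Proof.
move=> bA mA; rewrite /circuit fcircuit_dep //=.
by apply/forallP => D; apply/implyP; apply: fcircuit_sub.
Qed.

(** Turns the condition in the definition of L_C into a sum over the elements
outside the basis, each of which determines its circuit. *)
Lemma fcircuit_uniq A C m : is_basis b A -> circuit b C ->
  (m \in C) && (C :\ m \subset A) = (m \notin A) && (C == fcircuit A m).
Proof.
move=> bA circC; have /andP[_ indA] := bA; have /andP[depC /forallP minC] := circC.
apply/andP/andP => [[mC sCA]|[mA /eqP->]]; last first.
  split; first by rewrite inE fundrel1 // oner_neq0.
  by apply/subsetP => i; rewrite !inE => /andP[/negPf ni] /fundrel_neq0_in; rewrite !inE ni.
have mA : m \notin A.
  apply: contra depC => mA; apply: indepS indA; rewrite -(setD1K mC).
  by rewrite subUset sub1set mA.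
split=> //; have sCU : C \subset m |: A by rewrite -(setD1K mC) setUS.
have subC : fcircuit A m \subset C.
  apply/negPn/negP => /subsetPn[r]; rewrite inE => nz rC; case/negP: depC.
  apply/indepP => c sc rc l.
  have cE : forall l, c l = c m * fundrel b A m l.
    by apply: linrel_uniq => // j jU; apply: sc; apply: contra jU; apply/subsetP.
  have := cE r; rewrite sc // => /esym/eqP.
  by rewrite mulf_eq0 (negPf nz) orbF => /eqP cm; rewrite cE cm mul0r.
rewrite eqEsubset subC andbT; apply: contraT => nsub.
have /implyP := minC (fcircuit A m).
by rewrite properE subC nsub => /(_ isT); rewrite (negPf (fcircuit_dep bA mA)).
Qed.

(** On a fundamental circuit the given coefficients are, up to normalization,
the fundamental relation, by uniqueness of the latter. *)
Lemma circuit_coeffs_fcircuit lam A m : circuit_coeffs b lam ->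
    is_basis b A -> m \notin A ->
  lam (fcircuit A m) m != 0 /\
  (forall l, fundrel b A m l = lam (fcircuit A m) l / lam (fcircuit A m) m).
Proof.
move=> hlam bA mA; have [[i iC nz] rc sc] := hlam _ (fcircuitP bA mA).
set c := lam _ in nz rc sc *.
have cE : forall l, c l = c m * fundrel b A m l.
  apply: linrel_uniq => // [j jU|].
    by apply: sc; apply: contra jU; rewrite inE; apply: fundrel_neq0_in.
  rewrite /linrel (bigID (mem (fcircuit A m))) /= rc add0r big1 // => j jC.
  by rewrite sc // scale0r.
have cm0 : c m != 0 by apply: contraNneq nz => cm; rewrite cE cm mul0r.
by split=> // l; rewrite cE mulrC mulKf.
Qed.

(** The fundamental relation is a nonzero multiple of [lam C] for its circuit C,
so this is f_C(z) <> 0. *)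
Lemma relval_fundrel_neq0 lam z : circuit_coeffs b lam -> ~ Delta b lam z ->
  forall A m, is_basis b A -> m \notin A -> relval z (fundrel b A m) != 0.
Proof.
move=> hlam hz A m bA mA; apply/eqP => p0; apply: hz.
have [nz rE] := circuit_coeffs_fcircuit hlam bA mA.
exists (fcircuit A m); first exact: fcircuitP.
transitivity (lam (fcircuit A m) m * relval z (fundrel b A m)); last by rewrite p0 mulr0.
rewrite mulr_sumr; apply: eq_bigr => i _.
by rewrite rE mulrA mulrCA divff // mulr1.
Qed.

End FundamentalCircuit.

Section KMatrix.
Context (F : fieldType) (n k : nat) (b : 'M[F]_(n, k)).
Context (a z : 'I_n -> F) (lam : {set 'I_n} -> 'I_n -> F).
Hypothesis hlam : circuit_coeffs b lam.
Implicit Types (A C D : {set 'I_n}) (I : kindep b).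

Lemma LC_basisE C I : circuit b C ->
  LC_basis a C I = \sum_(m | (m \notin val I) && (C == fcircuit b (val I) m))
    LCsub b a C m (enum (val I)).
Proof.
move=> circC; have bI := kindep_basis I.
apply: eq_big => [m|m /andP[mC sCI]]; first exact: fcircuit_uniq.
have mI : m \notin val I.
  by have := fcircuit_uniq m bI circC; rewrite mC sCI => /esym/andP[].
have rE l : l \in C -> enum (C :\ l) = rem l (enum C).
  move=> lC; rewrite rem_filter ?enum_uniq // /enum_mem -filter_predI.
  by apply: eq_filter => x; rewrite !inE.
under [X in _ *: (_ *: X)]eq_bigr => l lC do rewrite rE //.
have pI : perm_eq (enum (C :\ m) ++ enum (val I :\: C)) (enum (val I)).
  apply: uniq_perm; rewrite ?enum_uniq //.
    rewrite cat_uniq !enum_uniq andbT; apply/hasPn => x.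
    by rewrite !mem_enum !inE negb_and => /andP[-> _]; rewrite orbT.
  move=> x; rewrite mem_cat !mem_enum !in_setD in_set1.
  have [->|nxm] /= := eqVneq x m; first by rewrite mC (negPf mI).
  case: (boolP (x \in C)) => //= xC; apply/esym.
  by apply: (subsetP sCI); rewrite !inE nxm.
have [d [FE LE]] := LCsub_perm b a C m (size_kindep I) pI.
have cC : enum C =i C by move=> x; rewrite mem_enum.
have mc : m \in enum C by rewrite mem_enum.
have sC : {in enum (val I :\: C), forall x, x \notin C}.
  by move=> x; rewrite mem_enum inE => /andP[].
have szC : size (rem m (enum C) ++ enum (val I :\: C)) = k.
  by rewrite -rE // (perm_size pI) size_kindep.
have E := LCsubE b a (enum_uniq C) cC mc sC szC.
rewrite FE E -rE // LE Fflag_enum.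
have -> : ((-1) ^+ d *: Fbasis I : V b) I = (-1) ^+ d.
  by rewrite !ffunE eqxx; exact: mulr1.
by rewrite scalerA -expr2 sqrr_sign scale1r.
Qed.

(** Cramer's rule turns the signed flags of L_C into the coefficients of the
fundamental relation; the term l = m is the diagonal one. *)
Lemma LCsub_fcircuit I m (I' : kindep b) : m \notin val I ->
  LCsub b a (fcircuit b (val I) m) m (enum (val I)) I' =
  \sum_l a l * fundrel b (val I) m l *
    ((swap (val I) m l == val I')%:R *
     (minor b (enum (val I)) / minor b (enum (val I')))).
Proof.
move=> mI; have bI := kindep_basis I.
have DI := minor_neq0 bI; have DI' := minor_neq0 (kindep_basis I').
rewrite /LCsub Fflag_enum [RHS](bigD1 m) //= fundrel1 // mulr1 swap_id //.
rewrite !ffunE; congr (_ + _).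
  rewrite -[LHS]/(a m * (I == I')%:R) val_eqE; congr (_ * _).
  by case: eqP => [<-|_]; rewrite ?mul0r ?mul1r ?mulfV.
rewrite sum_ffunE -sumrN big_mkcond [RHS]big_mkcond; apply: eq_bigr => l _.
rewrite !inE; case: eqP => //= nlm; rewrite ?andbF //.
case: eqP => [->|/eqP nz]; first by rewrite mulr0 mul0r.
have lI : l \in val I.
  by move: (fundrel_neq0_in nz); rewrite !inE => /predU1P[].
rewrite ffunE -[X in - X]/(a l * _) FflagE ?size_map ?size_kindep // swap_sub1 //.
rewrite (minor_sub1 bI (perm_refl _) lI mI); by ring.
Qed.

Definition Kmx j (I I' : kindep b) : F :=
  \sum_(m | m \notin val I) dlogcoef z j (fundrel b (val I) m) *
    \sum_l a l * fundrel b (val I) m l *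
    ((swap (val I) m l == val I')%:R *
     (minor b (enum (val I)) / minor b (enum (val I')))).

(** Exchanging the sums over the circuits and over the entering elements leaves
exactly one circuit for each of the latter. *)
Lemma Kop_Fbasis j (I I' : kindep b) : Kop b a lam z j (Fbasis I) I' = Kmx j I I'.
Proof.
rewrite /Kop sum_lfunE sum_ffunE.
transitivity (\sum_(C | circuit b C) \sum_(m | (m \notin val I) && (C == fcircuit b (val I) m))
   lam C j / fcirc lam C z * LCsub b a C m (enum (val I)) I').
  apply: eq_bigr => C cC; rewrite scale_lfunE LC_Fbasis LC_basisE // ffunE sum_ffunE.
  by rewrite -[LHS]/(_ * _) mulr_sumr.
rewrite (exchange_big_dep (fun m => m \notin val I)) /=; last by move=> C m _ /andP[].
apply: eq_bigr => m mI; have bI := kindep_basis I.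
rewrite (big_pred1 (fcircuit b (val I) m)) => [|C]; last first.
  by rewrite mI /=; case: eqP => [->|]; rewrite ?andbF // fcircuitP.
rewrite LCsub_fcircuit //; congr (_ * _).
have [nz rE] := circuit_coeffs_fcircuit hlam bI mI.
by rewrite (dlogcoef_scale z j nz rE).
Qed.

Lemma prod_swap A m l : m \notin A -> l \in m |: A ->
  (\prod_(i in swap A m l) a i) * a l = (\prod_(i in A) a i) * a m.
Proof.
move=> mA lU; transitivity (\prod_(i in m |: A) a i).
  by rewrite [RHS](big_setD1 l) //= mulrC.
by rewrite [LHS](big_setD1 m) ?setU11 //= mulrC setU1K.
Qed.

(** The exchange of l for m from I to I' is the inverse of the exchange of m
for l from I' to I.  The two coefficients agree because the relation is only
renormalized ([fundrel_swap_back]) and because of [minor_swap_sqr]. *)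
Lemma Kmx_sym j (I I' : kindep b) :
  (\prod_(i in val I') a i) * Kmx j I I' = (\prod_(i in val I) a i) * Kmx j I' I.
Proof.
pose X (I1 I2 : kindep b) m l :=
  if (m \notin val I1) && (swap (val I1) m l == val I2) then
    (\prod_(i in val I2) a i) * (dlogcoef z j (fundrel b (val I1) m) *
     (a l * fundrel b (val I1) m l *
      (minor b (enum (val I1)) / minor b (enum (val I2))))) else 0.
have XE (I1 I2 : kindep b) : (\prod_(i in val I2) a i) * Kmx j I1 I2 = \sum_m \sum_l X I1 I2 m l.
  rewrite /Kmx mulr_sumr big_mkcond; apply: eq_bigr => m _; rewrite /X.
  case: ifP => mI; last by rewrite big1.
  rewrite !mulr_sumr; apply: eq_bigr => l _; case: eqP => _ /=; first by rewrite mul1r.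
  by rewrite mul0r !mulr0.
rewrite !XE exchange_big; apply: eq_bigr => l _; apply: eq_bigr => m _.
have half (I1 I2 : kindep b) p q : p \notin val I1 -> swap (val I1) p q = val I2 ->
    X I1 I2 p q = X I2 I1 q p.
  move=> pI e; have b1 := kindep_basis I1; have b2 := kindep_basis I2.
  have D1 := minor_neq0 b1; have D2 := minor_neq0 b2.
  have qU : q \in p |: val I1.
    apply/negPn/negP => qU; have /andP[/eqP c1 _] := b1; have /andP[/eqP c2 _] := b2.
    move: e => /(congr1 (fun A : {set 'I_n} => #|A|)); rewrite c2 /swap => e.
    have := cardsD1 q (p |: val I1).
    by rewrite e cardsU1 pI c1 (negPf qU) add0n add1n => /eqP; rewrite eqn_leq ltnn.
  have nz : fundrel b (val I1) p q != 0.
    apply/negP => /eqP rq; have /andP[_ /indepP ind2] := b2.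
    have sup : supported (val I2) (fundrel b (val I1) p).
      move=> i iI2; have [->//|niq] := eqVneq i q.
      by rewrite fundrel_out //; apply: contra iI2 => iU; rewrite -e in_setD1 niq.
    have /eqP := ind2 _ sup (linrel_fundrel p b1) p.
    by rewrite fundrel1 // oner_eq0.
  have qI2 : q \notin val I2 by rewrite -e !inE eqxx.
  have e' : swap (val I2) q p = val I1 by rewrite -e /swap setD1K // setU1K.
  rewrite /X pI e eqxx qI2 e' eqxx /= -e (dlogcoef_scale z j nz (fundrel_swap_back b1 pI nz)).
  rewrite fundrel_swap_back // fundrel1 // -/(swap _ _ _) e.
  have P := prod_swap pI qU; have DD := minor_swap_sqr b1 pI nz.
  rewrite e in P DD; set r := dlogcoef _ _ _.
  set d1 := minor b _ in D1 DD *; set d2 := minor b _ in D2 DD *.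
  set rq := fundrel _ _ _ _ in nz DD *.
  transitivity (r * (\prod_(i in val I2) a i * a q) * (rq * d1 / d2)); first by ring.
  have -> : rq * d1 / d2 = d2 / (rq * d1).
    have rd : rq * d1 != 0 by rewrite mulf_neq0.
    by apply/eqP; rewrite eqr_div // -!expr2 DD.
  by rewrite P; field; rewrite nz D1.
rewrite /X; case: ifP => [/andP[mI /eqP e]|].
  by have := half _ _ _ _ mI e; rewrite /X mI e eqxx.
move=> H; case: ifP => // /andP[lI /eqP e].
by have := half _ _ _ _ lI e; rewrite /X lI e eqxx /= => ->; rewrite H.
Qed.

End KMatrix.

(** * Independence of the logarithmic forms *)

(** In characteristic 0 the natural numbers are infinitely many points. *)
Lemma poly_nat_nonroot (F : numFieldType) (p : {poly F}) :
  p != 0 -> exists u : nat, p.[u%:R] != 0.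
Proof.
move=> nz; pose rs : seq F := [seq u%:R | u <- iota 0 (size p)].
have /allPn[_ /mapP[u _ ->] nu] : ~~ all (root p) rs; last by exists u.
apply/negP => all_roots; have := max_poly_roots nz all_roots.
rewrite size_map size_iota ltnn => /(_ _)/negP[] //.
by rewrite map_inj_uniq ?iota_uniq //; apply: mulrIn; rewrite oner_eq0.
Qed.

Section Forms.
Context (F : numFieldType) (n k : nat) (b : 'M[F]_(n, k)) (z : 'I_n -> F).
Implicit Types (A : {set 'I_n}) (I : kindep b) (t : 'cV[F]_k).

(** Along the moment curve each g_j is a nonzero polynomial. *)
Lemma exists_direction : (forall j, row j b <> 0) ->
  exists v : 'cV[F]_k, forall j, glin b j v != 0.
Proof.
move=> hb; pose P j : {poly F} := \poly_(i < k) (if insub i is Some i then b j i else 0).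
have PE j u : (P j).[u] = glin b j (\col_i u ^+ i).
  rewrite horner_poly /glin; apply: eq_bigr => i _; by rewrite valK mxE.
have P0 j : P j != 0.
  apply/eqP => Pj; apply: (hb j); apply/rowP => i; rewrite !mxE.
  have := congr1 (fun p : {poly F} => p`_i) Pj.
  by rewrite coef_poly coef0 ltn_ord valK.
have nz : \prod_j P j != 0 by apply/prodf_neq0.
have [u nu] := poly_nat_nonroot nz.
exists (\col_i u%:R ^+ i) => j; rewrite -PE.
by move: nu; rewrite horner_prod => /prodf_neq0; apply.
Qed.

(** For j in A the relation is 0, so the point is the common point of the
hyperplanes H_j, j in A; for j outside A it lies off H_j as soon as z is
generic. *)
Lemma exists_vertex A : is_basis b A ->
  exists t, forall j, faff b z j t = relval z (fundrel b A j).
Proof.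
move=> bA; pose zc : 'cV[F]_n := \col_i z i.
exists (- (invmx (selmx F k (enum A) *m b) *m (selmx F k (enum A) *m zc))) => j.
have gE t : glin b j t = (b *m t) j 0 by rewrite mxE.
rewrite /faff gE mulmxN !mulmxA -/(coordmx b A) mxE /relval.
rewrite /fundrel; under [RHS]eq_bigr do rewrite mulrBl.
rewrite sumrB (bigD1 j) //= eqxx mul1r big1 ?addr0 => [|i /negPf->]; last by rewrite mul0r.
congr (_ - _); rewrite mxE; apply: eq_bigr => i _; congr (_ * _).
by rewrite mxE.
Qed.

(** omega_j is dg_j divided by f_j, so the denominators factor out of the
determinant and a product of matrices remains. *)
Lemma omegasE (s : k.-tuple 'I_n) t v :
  omegas b z s t v = minor b s * \det (\matrix_(i, j) v j i 0) / \prod_(i <- s) faff b z i t.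
Proof.
rewrite /omegas /wedges /minor -det_mulmx.
have -> : (\prod_(i <- s) faff b z i t)^-1 =
    \det (diag_mx (\row_i (faff b z (tnth s i) t)^-1)).
  by rewrite det_diag big_tuple -prodfV; apply: eq_bigr => i _; rewrite mxE.
rewrite mulrC -det_mulmx; congr (\det _); apply/matrixP => i j.
have x0 := tnth s i.
rewrite mul_diag_mx !mxE /omega mulrC; congr (_ * _).
apply: eq_bigr => l _; rewrite (selmx_mulE _ x0) ?size_tuple // !mxE.
by rewrite -tnth_nth.
Qed.

Lemma kindep_tupleE I : kindep_tuple I = enum (val I) :> seq 'I_n.
Proof. by rewrite /kindep_tuple val_tcast. Qed.

(** This is what [Fflag] encodes: a wedge product of the omega_j is zero or,
up to sign, one of the basis forms. *)
Lemma omegas_Fflag (s : k.-tuple 'I_n) t v :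
  omegas b z s t v = \sum_I Fflag b s I * omegas b z (kindep_tuple I) t v.
Proof.
have sz : size s = k by rewrite size_tuple.
rewrite omegasE; have [m0|nz] := eqVneq (minor b s) 0.
  by rewrite m0 !mul0r big1 // => I _; rewrite FflagE // m0 mul0r mulr0 mul0r.
have [us bs] := minor_basis sz nz; pose I0 : kindep b := Sub _ bs.
have DI := minor_neq0 bs.
rewrite [RHS](bigD1 I0) //= [X in _ + X]big1 ?addr0 => [|I nI]; last first.
  rewrite FflagE //; case: eqP => [e|]; last by rewrite !mul0r.
  by case/eqP: nI; apply: val_inj.
rewrite FflagE // eqxx mul1r omegasE kindep_tupleE.
have -> : \prod_(i <- enum (val I0)) faff b z i t = \prod_(i <- s) faff b z i t.
  by apply: perm_big; apply: uniq_perm; rewrite ?enum_uniq // => x; rewrite mem_enum inE.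
by rewrite !mulrA divfK.
Qed.

Hypothesis nonzero_rows : forall j, row j b <> 0.
Hypothesis generic : forall A m, is_basis b A -> m \notin A ->
  relval z (fundrel b A m) != 0.

(** On a generic line through the vertex of I0, clearing denominators gives a
polynomial identity, valid at all but finitely many points of the line and hence
at the vertex.  There each term with I <> I0 contains a factor f_i with i in I0,
and the term of I0 is psi I0 times a nonzero number. *)
Lemma omegas_free (psi : kindep b -> F) :
  (forall t, in_compl b z t -> forall v,
     \sum_I psi I * omegas b z (kindep_tuple I) t v = 0) ->
  forall I, psi I = 0.
Proof.
move=> rel I0; have b0 := kindep_basis I0.
have [t0 t0E] := exists_vertex b0; have [v0 v0n] := exists_direction nonzero_rows.
pose f j : {poly F} := (faff b z j t0)%:P + glin b j v0 *: 'X.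
have fE j u : (f j).[u] = faff b z j (t0 + u *: v0).
  rewrite /f !hornerE /faff -addrA; congr (_ + _).
  rewrite /glin mulr_suml -big_split; apply: eq_bigr => i _.
  by rewrite !mxE /=; ring.
have fn0 : \prod_j f j != 0.
  apply/prodf_neq0 => j _; apply: contra (v0n j) => /eqP/(congr1 (fun p : {poly F} => p`_1)).
  by rewrite coefD coefC coefZ coefX coef0 /= add0r mulr1 => ->.
(* The relation multiplied by the product of all f_j, along the line. *)
pose P : {poly F} := \sum_I (psi I * minor b (enum (val I))) *: \prod_(j | j \notin val I) f j.
have P0 : P = 0.
  apply: (mulIf fn0); rewrite mul0r; apply/eqP; apply: contraT => /poly_nat_nonroot[u] /eqP[].
  rewrite hornerM; have [->|nz] := eqVneq (\prod_j f j).[u%:R] 0; first by rewrite mulr0.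
  have fu j : faff b z j (t0 + u%:R *: v0) != 0.
    by rewrite -fE; move: nz; rewrite horner_prod => /prodf_neq0; apply.
  have := rel _ fu (fun j => delta_mx j 0) => /(congr1 (fun y => (\prod_j f j).[u%:R] * y)).
  rewrite mulr0 => relu; suff -> : P.[u%:R] = 0 by rewrite mul0r.
  rewrite -[RHS]relu horner_sum mulr_sumr; apply: eq_bigr => I _.
  rewrite hornerZ -mulrA [RHS]mulrCA; congr (_ * _).
  rewrite omegasE kindep_tupleE.
  have -> : \det (\matrix_(i < k, j < k) (delta_mx j 0 : 'cV[F]_k) i 0) = 1.
    by rewrite -[RHS](det1 F k); congr (\det _); apply/matrixP => i j; rewrite !mxE eqxx andbT.
  rewrite mulr1 mulrCA; congr (_ * _).
  rewrite !horner_prod [X in _ = X / _](bigID (mem (val I))) big_enum /=.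
  under [X in _ = _ / X]eq_bigr do rewrite -fE.
  rewrite mulrAC divff ?mul1r //; apply/prodf_neq0 => i _; rewrite fE; exact: fu.
have : P.[0] = 0 by rewrite P0 horner0.
rewrite horner_sum (bigD1 I0) //= [X in _ + X]big1 ?addr0 => [|I nI]; last first.
  rewrite hornerZ horner_prod.
  have [i iI0 iI] : exists2 i, i \in val I0 & i \notin val I.
    apply/subsetPn; apply: contra nI => sI; apply/eqP/val_inj/eqP.
    by rewrite eq_sym eqEcard sI !cardE !size_kindep leqnn.
  rewrite (bigD1 i) //= fE scale0r addr0 t0E /relval big1 ?mul0r ?mulr0 // => l _.
  by rewrite fundrel_in // mul0r.
rewrite hornerZ horner_prod => /eqP; rewrite !mulf_eq0 (negPf (minor_neq0 b0)) orbF.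
case/orP => [/eqP//|]; rewrite prodf_seq_eq0 => /hasP[i _ /andP[iI]].
by rewrite fE scale0r addr0 t0E (negPf (generic b0 iI)).
Qed.

End Forms.

(** * Sign-free coordinates on V *)

Section Coordinates.
Context (F : numFieldType) (n k : nat) (b : 'M[F]_(n, k)).
Context (a z : 'I_n -> F) (lam : {set 'I_n} -> 'I_n -> F).
Hypothesis ha : forall j, a j != 0.
Hypothesis hlam : circuit_coeffs b lam.
Hypothesis generic : forall A m, is_basis b A -> m \notin A ->
  relval z (fundrel b A m) != 0.
Implicit Types (A C D : {set 'I_n}) (I : kindep b) (x y : V b).

Lemma V_basisE x : x = \sum_I x I *: Fbasis I.
Proof.
apply/ffunP => I; rewrite sum_ffunE (bigD1 I) //= !ffunE eqxx.
rewrite [X in _ + X]big1 ?addr0 => [|J nJ]; first by rewrite -[RHS]/(_ * 1) mulr1.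
by rewrite !ffunE (negPf nJ) scaler0.
Qed.

Lemma Kop_coord j x I' : Kop b a lam z j x I' = \sum_I x I * Kmx a z j I I'.
Proof.
rewrite {1}(V_basisE x) linear_sum sum_ffunE; apply: eq_bigr => I _.
by rewrite linearZ ffunE Kop_Fbasis.
Qed.

Lemma Sform_Kop j x y :
  Sform a (Kop b a lam z j x) y = Sform a x (Kop b a lam z j y).
Proof.
transitivity (\sum_(I' : kindep b) \sum_(I : kindep b)
  (\prod_(i in val I') a i) * Kmx a z j I I' * x I * y I').
  apply: eq_bigr => I' _; rewrite Kop_coord mulr_sumr mulr_suml.
  by apply: eq_bigr => I _; rewrite -!mulrA [x I * _]mulrCA.
rewrite exchange_big; apply: eq_bigr => I _; rewrite Kop_coord mulr_sumr.
apply: eq_bigr => I' _; rewrite Kmx_sym; ring.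
Qed.

(** The coordinate of the functional S(x, _) on the form omega_A, divided by the
minor of A to remove the dependence on orderings.  The value is 0 if A is not a
basis. *)
Definition wcoord x A : F :=
  \sum_(I : kindep b | val I == A) (\prod_(i in A) a i) * x I / minor b (enum A).

Lemma wcoordE x I : wcoord x (val I) =
  (\prod_(i in val I) a i) * x I / minor b (enum (val I)).
Proof. by rewrite /wcoord (big_pred1 I). Qed.

Lemma wcoord_inj x y : (forall A, is_basis b A -> wcoord x A = wcoord y A) -> x = y.
Proof.
move=> e; apply/ffunP => I; have bI := kindep_basis I.
have := e _ bI; rewrite !wcoordE => /(mulIf _) E.
apply: (mulfI _ (E _)); last by rewrite invr_eq0 minor_neq0.
by apply/prodf_neq0.
Qed.

(** By symmetry K_j may be moved to the other argument of S, and then only its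
values on the basis vectors matter. *)
Lemma wcoord_Kop j x A : is_basis b A ->
  wcoord (Kop b a lam z j x) A = Kcoord b a z j (wcoord x) A.
Proof.
move=> bA; pose I : kindep b := Sub A bA; rewrite -[A]/(val I) wcoordE Kop_coord.
transitivity (\sum_(I' : kindep b) (\prod_(i in val I') a i) * Kmx a z j I I' * x I' /
    minor b (enum (val I))).
  rewrite mulr_sumr mulr_suml; apply: eq_bigr => I' _.
  by rewrite Kmx_sym -!mulrA [x I' * _]mulrCA !mulrA.
have DI := minor_neq0 (kindep_basis I).
transitivity (\sum_(I' : kindep b) \sum_(m | m \notin val I) \sum_l
   dlogcoef z j (fundrel b (val I) m) *
   (a l * fundrel b (val I) m l * (if swap (val I) m l == val I' then
      (\prod_(i in val I') a i) * x I' / minor b (enum (val I')) else 0))).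
  apply: eq_bigr => I' _; have DI' := minor_neq0 (kindep_basis I'); rewrite /Kmx.
  move: (minor b _) (minor b _) DI DI' => d d' d0 d0'.
  rewrite mulr_sumr !mulr_suml; apply: eq_bigr => m _.
  rewrite !mulr_sumr !mulr_suml; apply: eq_bigr => l _.
  by case: eqP => _ /=; [field; rewrite ?d0 ?d0' | rewrite !(mul0r, mulr0)].
rewrite exchange_big; apply: eq_bigr => m _; rewrite exchange_big /= /exchange_sum mulr_sumr.
apply: eq_bigr => l _; rewrite -!mulr_sumr; congr (_ * (_ * _)).
rewrite -big_mkcond /wcoord; apply: eq_big => [I'|I' /eqP->//]; exact: eq_sym.
Qed.

Lemma Kcoord_ext j w w' A : is_basis b A ->
  (forall B, is_basis b B -> w B = w' B) -> Kcoord b a z j w A = Kcoord b a z j w' A.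
Proof.
move=> bA e; apply: eq_bigr => m mA; congr (_ * _); apply: eq_bigr => l _.
have [->|nz] := eqVneq (fundrel b A m l) 0; first by rewrite mulr0 !mul0r.
by rewrite e // swap_basis.
Qed.

Lemma Kop_comm i j x :
  Kop b a lam z i (Kop b a lam z j x) = Kop b a lam z j (Kop b a lam z i x).
Proof.
apply: wcoord_inj => A bA.
have E i' j' : wcoord (Kop b a lam z i' (Kop b a lam z j' x)) A =
    Kcoord b a z i' (Kcoord b a z j' (wcoord x)) A.
  rewrite (wcoord_Kop i' (Kop b a lam z j' x) bA).
  by apply: Kcoord_ext => // B; apply: wcoord_Kop.
by rewrite (E i j) (E j i) Kcoord_comm.
Qed.

Lemma Kop_singular j x : singular b (wcoord x) -> singular b (wcoord (Kop b a lam z j x)).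
Proof.
move=> /(Kcoord_singular a z j) sx A q bA qA; rewrite wcoord_Kop // (sx A q) //.
apply: eq_bigr => p pA; have [->|nz] := eqVneq (fundrel b A p q) 0; first by rewrite !mul0r.
by rewrite wcoord_Kop // swap_basis.
Qed.

(** The value at x of the element (H_s) of the dual space. *)
Definition flagval x (s : seq 'I_n) : F := \sum_I x I * Fflag b s I.

Lemma flagvalE x s : size s = k -> (\prod_(i <- s) a i) * flagval x s =
  minor b s * wcoord x [set i in s].
Proof.
move=> sz; have [m0|nz] := eqVneq (minor b s) 0.
  rewrite m0 mul0r /flagval [X in _ * X]big1 ?mulr0 // => I _.
  by rewrite FflagE // m0 mul0r mulr0 mulr0.
have [us bs] := minor_basis sz nz.
have -> : \prod_(i <- s) a i = \prod_(i in [set i in s]) a i.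
  rewrite big_uniq //=; apply: eq_bigl => i; by rewrite inE.
rewrite /wcoord /flagval !mulr_sumr [RHS]big_mkcond; apply: eq_bigr => I _.
rewrite FflagE // eq_sym; case: eqP => [e|]; last by rewrite mul0r !mulr0.
have DI := minor_neq0 bs; rewrite -e in DI *; rewrite mul1r; by field.
Qed.

(** The left side is the pairing of x with nu /\ omega_s, up to the
weights of s.  The element q, for which q :: s orders A, serves to express all the
other flags p :: s by Cramer's rule. *)
Lemma flagval_sum x q s A : is_basis b A -> perm_eq (q :: s) (enum A) ->
  (\prod_(i <- s) a i) * (\sum_j a j * flagval x (j :: s)) =
  minor b (q :: s) *
    (wcoord x A - \sum_(p | p \notin A) fundrel b A p q * wcoord x (swap A p q)).
Proof.
move=> bA pA; have sz : size (q :: s) = k by rewrite (perm_size pA) (size_enum_basis bA).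
have memA i : (i \in A) = (i == q) || (i \in s).
  by rewrite -mem_enum -(perm_mem pA) inE.
have qs : q \notin s by move: (perm_uniq pA); rewrite enum_uniq => /andP[].
have qA : q \in A by rewrite memA eqxx.
have szj j : size (j :: s) = k by [].
transitivity (\sum_j minor b (j :: s) * wcoord x [set i in j :: s]).
  by rewrite mulr_sumr; apply: eq_bigr => j _; rewrite -flagvalE // big_cons mulrCA mulrA.
rewrite (bigID (mem A)) /= (bigD1 q) //= [X in _ + X + _]big1 ?addr0; last first.
  move=> j /andP[jA njq]; have js : j \in s by move: jA; rewrite memA (negPf njq).
  have [->|nz] := eqVneq (minor b (j :: s)) 0; first by rewrite mul0r.
  by have [] := minor_basis (szj j) nz; rewrite /= js.
rewrite mulrBr; congr (_ * wcoord x _ + _).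
  by apply/setP => i; rewrite !inE memA.
rewrite mulr_sumr -sumrN; apply: eq_bigr => p pA'.
have -> : p :: s = map (sub1 q p) (q :: s).
  by rewrite /= map_sub1_id // /sub1 eqxx.
rewrite (minor_sub1 bA pA qA pA') /= map_sub1_id // /sub1 eqxx.
have -> : [set i in p :: s] = swap A p q.
  apply/setP => i; rewrite !inE memA; case: (eqVneq i q) => [->|_] //=.
  by rewrite (negPf qs) orbF; apply: contraNF pA' => /eqP <-.
by ring.
Qed.

Lemma singularP x : singular b (wcoord x) <->
  forall s : seq 'I_n, (size s).+1 = k -> \sum_j a j * flagval x (j :: s) = 0.
Proof.
split=> [sx s sz|sx A q bA qA].
  have [/forallP m0|/forallPn[q nz]] := boolP [forall j, minor b (j :: s) == 0].
    rewrite big1 // => j _; rewrite /flagval big1 ?mulr0 // => I _.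
    by rewrite FflagE ?(eqP (m0 j)) ?mul0r ?mulr0.
  have [us bA] := minor_basis (s := q :: s) sz nz.
  have pA : perm_eq (q :: s) (enum [set i in q :: s]).
    by apply: uniq_perm; rewrite ?enum_uniq // => i; rewrite mem_enum [RHS]inE.
  have := flagval_sum x bA pA; rewrite -sx ?subrr ?mulr0; first last.
  - by rewrite !inE eqxx.
  - exact: bA.
  move/eqP; rewrite mulf_eq0 => /orP[|/eqP//].
  by rewrite prodf_seq_eq0 => /hasP[i _]; rewrite (negPf (ha i)) andbF.
have pA : perm_eq (q :: rem q (enum A)) (enum A).
  by rewrite perm_sym perm_to_rem // mem_enum.
have := flagval_sum x bA pA; rewrite sx ?mulr0; last first.
  by rewrite -[RHS](size_enum_basis bA) -(perm_size pA).
move/esym/eqP; rewrite mulf_eq0 subr_eq0 => /orP[/eqP m0|/eqP//].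
have := minor_perm_sqr bA pA; rewrite m0 => /esym/eqP.
by rewrite expr0n /= sqrf_eq0 (negPf (minor_neq0 bA)).
Qed.

Lemma Vdual_basisE (phi : Vdual b) x : phi x = \sum_I x I * phi (Fbasis I).
Proof.
rewrite {1}(V_basisE x) linear_sum; apply: eq_bigr => I _.
by rewrite linearZ.
Qed.

(** The contravariant form is nondegenerate as all the weights are nonzero. *)
Lemma Vdual_Smap (phi : Vdual b) : exists x, phi = Smap b a x.
Proof.
exists [ffun I : kindep b => phi (Fbasis I) / \prod_(i in val I) a i].
apply/lfunP => y; rewrite SmapE Vdual_basisE; apply: eq_bigr => I _.
have P0 : \prod_(i in val I) a i != 0 by apply/prodf_neq0.
by rewrite ffunE [_ * (_ / _)]mulrC divfK // [LHS]mulrC.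
Qed.

Lemma dualop_Kop j x :
  dualop (Kop b a lam z j) (Smap b a x) = Smap b a (Kop b a lam z j x).
Proof. by apply/lfunP => y; rewrite comp_lfunE !SmapE Sform_Kop. Qed.

End Coordinates.

(** * Singular vectors in sign-free coordinates *)

Section Singular.
Context (F : numFieldType) (n k : nat) (b : 'M[F]_(n, k.+1)).
Context (a z : 'I_n -> F).
Hypothesis ha : forall j, a j != 0.
Hypothesis nonzero_rows : forall j, row j b <> 0.
Hypothesis generic : forall A m, is_basis b A -> m \notin A ->
  relval z (fundrel b A m) != 0.
Implicit Types (x : V b).

Lemma wedge_nu_omegas (s : k.-tuple 'I_n) t v :
  wedge (nu b a z) (omegas b z s : dform F k.+1 k.+1.-1) t v =
  \sum_j a j * omegas b z [tuple of j :: s] t v.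
Proof.
pose term j (i : 'I_k.+1) := (-1) ^+ i * (a j * omega b z j t (v i)) *
  omegas b z s t (fun l => v (lift i l)).
transitivity (\sum_j \sum_i term j i).
  rewrite exchange_big; apply: eq_bigr => i _.
  rewrite /nu /term; move: (omegas b z s _ _) => eta.
  by rewrite mulr_sumr mulr_suml.
apply: eq_bigr => j _; rewrite /omegas -wedge_wedges /wedge mulr_sumr.
apply: eq_bigr => i _; rewrite /term [_ * (a j * _)]mulrCA -!mulrA.
congr (_ * (_ * (_ * (_ * \det _)))); apply/matrixP => r c.
by rewrite !mxE (tnth_nth j) [in RHS](tnth_nth j).
Qed.

(** nu /\ eta is again a combination of the basis forms; its coefficients
evaluate at x to combinations of the sums in [singularP]. *)
Lemma wedge_nu_OS (eta : dform F k.+1 k) (c : k.-tuple 'I_n -> F) t v :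
  in_compl b z t ->
  eq_form b z eta (fun t v => \sum_s c s * omegas b z s t v) ->
  wedge (nu b a z) (eta : dform F k.+1 k.+1.-1) t v =
  \sum_I (\sum_s c s * \sum_j a j * Fflag b (j :: s) I) *
    omegas b z (kindep_tuple I) t v.
Proof.
move=> Ut etaE.
transitivity (\sum_s c s * wedge (nu b a z) (omegas b z s : dform F k.+1 k.+1.-1) t v).
  rewrite /wedge; transitivity (\sum_(i < k.+1) \sum_s c s * ((-1) ^+ i * nu b a z t (v i) *
     omegas b z s t (fun l => v (lift i l)))).
    apply: eq_bigr => i _; rewrite etaE // mulr_sumr; apply: eq_bigr => s _.
    by rewrite mulrCA.
  by rewrite exchange_big; apply: eq_bigr => s _; rewrite mulr_sumr.
under [RHS]eq_bigr do rewrite mulr_suml.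
rewrite exchange_big; apply: eq_bigr => s _; rewrite wedge_nu_omegas.
under [RHS]eq_bigr do rewrite -mulrA mulr_suml.
rewrite -mulr_sumr exchange_big; congr (_ * _); apply: eq_bigr => j _.
rewrite omegas_Fflag mulr_sumr; apply: eq_bigr => I _.
by rewrite mulrA.
Qed.

(** Testing with eta = omega_s gives the equations of [singularP].  Conversely
the functional representing nu /\ eta is determined by this form, by
independence of the omega_I, and it is the combination of these equations given
by [wedge_nu_OS]. *)
Lemma SingVP x : SingV a z x <-> singular b (wcoord a x).
Proof.
rewrite singularP //; split=> [sx s [sz]|sx eta [c etaE] phi phiE].
  have sz' : size s == k by apply/eqP.
  pose s' : k.-tuple 'I_n := Tuple sz'.
  (* u represents, through S, the functional attached to nu /\ omega_s. *)
  pose u : V b := [ffun I : kindep b =>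
    (\sum_j a j * Fflag b (j :: s) I) / \prod_(i in val I) a i].
  have uE (I : kindep b) :
      (\prod_(i in val I) a i) * u I = \sum_j a j * Fflag b (j :: s) I.
    have P0 : \prod_(i in val I) a i != 0 by apply/prodf_neq0.
    by rewrite ffunE [_ * (_ / _)]mulrC divfK.
  have SE (I : kindep b) : Smap b a u (Fbasis I) = \sum_j a j * Fflag b (j :: s) I.
    rewrite SmapE /Sform (bigD1 I) //= [X in _ + X]big1 ?addr0 => [|J nJ].
      by rewrite uE !ffunE eqxx mulr1.
    by rewrite [Fbasis I J]ffunE eq_sym (negPf nJ) mulr0.
  have := sx (omegas b z s') _ (Smap b a u) _; rewrite SmapE => S0.
  rewrite -[RHS]S0; first last.
  - move=> t Ut v; rewrite wedge_nu_omegas /to_OS.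
    under [LHS]eq_bigr do rewrite SE mulr_suml.
    rewrite exchange_big; apply: eq_bigr => j _.
    rewrite omegas_Fflag mulr_sumr; apply: eq_bigr => I _.
    by rewrite mulrA.
  - exists (fun r => (r == s')%:R) => t _ v.
    rewrite (bigD1 s') //= eqxx mul1r big1 ?addr0 // => r /negPf->.
    by rewrite mul0r.
  transitivity (\sum_I x I * \sum_j a j * Fflag b (j :: s) I).
    rewrite /flagval; under eq_bigr do rewrite mulr_sumr.
    rewrite exchange_big; apply: eq_bigr => I _; rewrite mulr_sumr.
    by apply: eq_bigr => j _; rewrite mulrCA.
  by apply: eq_bigr => I _; rewrite uE mulrC.
have phiI I : phi (Fbasis I) = \sum_s c s * \sum_j a j * Fflag b (j :: s) I.
  apply: subr0_eq; move: I; apply: (omegas_free nonzero_rows generic) => t Ut v.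
  under eq_bigr do rewrite mulrBl.
  by rewrite sumrB -(wedge_nu_OS v Ut etaE) -phiE // subrr.
rewrite Vdual_basisE; under eq_bigr do rewrite phiI mulr_sumr.
rewrite exchange_big big1 // => s _.
transitivity (c s * \sum_j a j * flagval x (j :: s)); last first.
  by rewrite sx ?mulr0 //= size_tuple.
rewrite mulr_sumr.
under eq_bigr do rewrite mulrCA mulr_sumr mulr_sumr.
rewrite exchange_big; apply: eq_bigr => j _.
rewrite /flagval !mulr_sumr; apply: eq_bigr => I _.
by congr (_ * _); rewrite mulrCA.
Qed.

End Singular.

(** * Invariance, symmetry and commutation on the dual space *)

Theorem lemma5p2 (R : realType) (n k : nat) (hk : (0 < k)%N) (hkn : (k < n)%N)
    (b : 'M[R[i]]_(n, k))
    (hb : forall j : 'I_n, row j b <> 0)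
    (hspan : <<[seq row j b | j <- enum 'I_n]>>%VS = fullv)
    (a : 'I_n -> R[i]) (ha : forall j : 'I_n, a j <> 0)
    (lam : {set 'I_n} -> 'I_n -> R[i]) (hlam : circuit_coeffs b lam)
    (z : 'I_n -> R[i]) (hz : ~ Delta b lam z) :
  [/\ forall phi : Vdual b, SingW a z phi -> phi \in W b a,
      forall j : 'I_n,
        (forall phi : Vdual b, phi \in W b a ->
           dualop (Kop b a lam z j) phi \in W b a) /\
        (forall phi : Vdual b, SingW a z phi ->
           SingW a z (dualop (Kop b a lam z j) phi)),
      forall (j : 'I_n) (phi psi : Vdual b), phi \in W b a -> psi \in W b a ->
        SformW a (dualop (Kop b a lam z j) phi) psi =
        SformW a phi (dualop (Kop b a lam z j) psi)
    & forall (i j : 'I_n) (phi : Vdual b), SingW a z phi ->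
        dualop (Kop b a lam z i) (dualop (Kop b a lam z j) phi) =
        dualop (Kop b a lam z j) (dualop (Kop b a lam z i) phi)].
Proof.
case: k hk hkn b hb hspan hlam hz => [hk|k _ _ b hb _ hlam hz]; first by case: (notF hk).
have a0 j : a j != 0 by apply/eqP.
have generic := relval_fundrel_neq0 hlam hz.
(* W is the whole dual space, and each of its elements comes from V. *)
have SW x : Smap b a x \in W b a by rewrite memv_img ?memvf.
have WS phi : exists x, phi = Smap b a x by apply: Vdual_Smap.
split=> [_ [x _ ->] //|j|j phi psi _ _|i j _ [x _ ->]].
- split=> [phi _|_ [x sx ->]].
    by have [x ->] := WS phi; rewrite dualop_Kop.
  exists (Kop b a lam z j x); last exact: dualop_Kop.
  apply/(SingVP a0 hb generic)/(Kop_singular z hlam).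
  exact/(SingVP a0 hb generic).
- have [x ->] := WS phi; have [y ->] := WS psi.
  by rewrite 2!(dualop_Kop a z hlam) 2!SformW_Smap (Sform_Kop a z hlam).
- have K2 r t := etrans (congr1 (dualop (Kop b a lam z r)) (dualop_Kop a z hlam t x))
    (dualop_Kop a z hlam r (Kop b a lam z t x)).
  exact: etrans (K2 i j) (etrans (congr1 (Smap b a) (Kop_comm a0 hlam generic i j x))
    (esym (K2 j i))).
Qed.
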